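(* Let $(R,\mathfrak m,k)$ be a $d$-dimensional Cohen-Macaulay local integral domain containing the field $k$. Fix a square-free monomial ideal $I\subset\mathfrak m$ with respect to a full system of parameters (that is, $I$ is generated by square-free monomials in a system of parameters $x_1,\dots,x_d$). Suppose $\ell_R\bigl(H^{d-i}_{\mathfrak m}(R/I)\bigr)<\infty$ for some fixed $i\ge 0$. Then the multiplication map $H^i_I(R)\xrightarrow{\times x}H^i_I(R)$ is surjective for some $x\in I$.
   Context: All rings are commutative, noetherian, with unity. $(R,\mathfrak m,k)$ denotes a local ring $R$ with maximal ideal $\mathfrak m$ and residue field $k$. For an ideal $J$ of $R$, $H^i_J(-)$ denotes the $i$-th local cohomology with support in $J$, and $\ell_R(-)$ denotes the length of an $R$-module.
   Formalization: The dimension d is assumed positive: for d = 0, R = k, I = 0, i = 0 the claim fails, since the length is finite but the only x in I is 0, which is not surjective on H^0_I(R) = k. *)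

(* Defs.v *)
From HB Require Import structures.
From mathcomp Require Import all_boot all_order all_algebra.
From mathcomp Require Import boolp classical_sets.

Set Implicit Arguments.
Unset Strict Implicit.
Unset Printing Implicit Defensive.

Import GRing.Theory.
Local Open Scope ring_scope.
Local Open Scope quotient_scope.
Local Open Scope classical_set_scope.

(* Since [boolp] makes every proposition decidable, the boolean predicates
   underlying [submodClosed M] represent all submodules of M. *)

Section Submodule.
Context {R : comNzRingType} {M : lmodType R} (N : submodClosed M).

Record submod := Submod { submod_val :> M; submod_valP : submod_val \in N }.

HB.instance Definition _ := [isSub for submod_val].
HB.instance Definition _ := [Choice of submod by <:].
HB.instance Definition _ := [SubChoice_isSubLmodule of submod by <:].

Lemma submod_val_linear : linear submod_val.
Proof. exact: (@linearP R submod M *:%R val). Qed.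

HB.instance Definition _ :=
  GRing.isLinear.Build R submod M *:%R submod_val submod_val_linear.

End Submodule.

Section QuotientModule.
Context {R : comNzRingType} {M : lmodType R} (N : submodClosed M).

(* [submodClosed] does not inherit from [zmodClosed], which [Quotient.quot]
   requires. *)
Definition quotmod_rel : {pred M} := N.

Lemma quotmod_rel_closed : zmod_closed quotmod_rel.
Proof. exact: submodClosedP. Qed.

HB.instance Definition _ := GRing.isZmodClosed.Build M quotmod_rel
  quotmod_rel_closed.

Definition quotmod : Type := Quotient.quot quotmod_rel.

HB.instance Definition _ := GRing.Zmodule.on quotmod.

Definition quotmod_pi (v : M) : quotmod := \pi_(Quotient.quot quotmod_rel) v.

Definition quotmod_scale (a : R) (u : quotmod) : quotmod :=
  quotmod_pi (a *: repr (u : Quotient.quot quotmod_rel)).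

Lemma quotmod_pi_eq (u v : M) : quotmod_pi u = quotmod_pi v <-> u - v \in N.
Proof.
by rewrite (Quotient.idealrBE quotmod_rel); split=> [uv|/eqP//]; apply/eqP.
Qed.

Lemma quotmod_piP (u : quotmod) : exists v, u = quotmod_pi v.
Proof. by exists (repr (u : Quotient.quot quotmod_rel)); rewrite /quotmod_pi reprK. Qed.

Lemma quotmod_piD (u v : M) :
  quotmod_pi (u + v) = quotmod_pi u + quotmod_pi v.
Proof. by rewrite /quotmod_pi piE. Qed.

Lemma quotmod_piZ (a : R) (v : M) :
  quotmod_scale a (quotmod_pi v) = quotmod_pi (a *: v).
Proof.
apply/quotmod_pi_eq; rewrite -scalerBr rpredZ//.
by apply/quotmod_pi_eq; rewrite /quotmod_pi reprK.
Qed.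

Lemma quotmod_scaleA a b u :
  quotmod_scale a (quotmod_scale b u) = quotmod_scale (a * b) u.
Proof. by have [v ->] := quotmod_piP u; rewrite !quotmod_piZ scalerA. Qed.

Lemma quotmod_scale1 : left_id 1 quotmod_scale.
Proof. by move=> u; have [v ->] := quotmod_piP u; rewrite quotmod_piZ scale1r. Qed.

Lemma quotmod_scaleDr : right_distributive quotmod_scale +%R.
Proof.
move=> a u v; have [u' ->] := quotmod_piP u; have [v' ->] := quotmod_piP v.
by rewrite -quotmod_piD !quotmod_piZ -quotmod_piD scalerDr.
Qed.

Lemma quotmod_scaleDl v : {morph quotmod_scale^~ v : a b / a + b}.
Proof.
move=> a b /=; have [v' ->] := quotmod_piP v.
by rewrite !quotmod_piZ -quotmod_piD scalerDl.
Qed.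

HB.instance Definition _ := GRing.Zmodule_isLmodule.Build R quotmod
  quotmod_scaleA quotmod_scale1 quotmod_scaleDr quotmod_scaleDl.

Lemma quotmod_pi_linear : linear quotmod_pi.
Proof. by move=> a u v; rewrite quotmod_piD -quotmod_piZ. Qed.

HB.instance Definition _ :=
  GRing.isLinear.Build R M quotmod *:%R quotmod_pi quotmod_pi_linear.

End QuotientModule.

Section SubmoduleConstructions.
Context {R : comNzRingType}.

Definition zero_submod (M : lmodType R) : {pred M} := pred1 0.
Arguments zero_submod M : clear implicits.

Lemma zero_submod_closed M : submod_closed (zero_submod M).
Proof.
split=> [|a u v]; first by rewrite inE.
by rewrite !inE => /eqP-> /eqP->; rewrite scaler0 addr0.
Qed.
HB.instance Definition _ M := GRing.isSubmodClosed.Build R M (zero_submod M)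
  (zero_submod_closed M).

Definition span {M : lmodType R} (S : set M) : {pred M} :=
  [pred v | `[< forall N : submodClosed M, S `<=` [set` N] -> v \in N >]].

Lemma span_closed (M : lmodType R) (S : set M) : submod_closed (span S).
Proof.
split=> [|a u v /asboolP Su /asboolP Sv]; apply/asboolP => N SN.
  exact: rpred0.
by rewrite rpredD ?rpredZ ?Su ?Sv.
Qed.
HB.instance Definition _ (M : lmodType R) (S : set M) :=
  GRing.isSubmodClosed.Build R M (span S) (span_closed S).

Definition kernel {A B : lmodType R} (f : {linear A -> B}) : {pred A} :=
  [pred a | f a == 0].

Lemma kernel_closed (A B : lmodType R) (f : {linear A -> B}) :
  submod_closed (kernel f).
Proof.
split=> [|a u v]; first by rewrite inE raddf0.
by rewrite !inE => /eqP fu /eqP fv; rewrite linearP fu fv scaler0 addr0.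
Qed.
HB.instance Definition _ (A B : lmodType R) (f : {linear A -> B}) :=
  GRing.isSubmodClosed.Build R A (kernel f) (kernel_closed f).

Definition image_of {A B : lmodType R} (f : {linear A -> B}) : {pred B} :=
  [pred b | `[< exists a, f a = b >]].

Lemma image_of_closed (A B : lmodType R) (f : {linear A -> B}) :
  submod_closed (image_of f).
Proof.
split=> [|a u v /asboolP[u' <-] /asboolP[v' <-]]; apply/asboolP.
  by exists 0; rewrite raddf0.
by exists (a *: u' + v'); rewrite linearP.
Qed.
HB.instance Definition _ (A B : lmodType R) (f : {linear A -> B}) :=
  GRing.isSubmodClosed.Build R B (image_of f) (image_of_closed f).

Definition restrict {M : lmodType R} (Z B : submodClosed M) :
  {pred submod Z} := [pred z | submod_val z \in B].
Arguments restrict {M} Z B.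

Lemma restrict_closed (M : lmodType R) (Z B : submodClosed M) :
  submod_closed (restrict Z B).
Proof.
split=> [|a u v]; first by rewrite inE linear0 rpred0.
by rewrite !inE => uB vB; rewrite linearP rpredD ?rpredZ.
Qed.
HB.instance Definition _ (M : lmodType R) (Z B : submodClosed M) :=
  GRing.isSubmodClosed.Build R (submod Z) (restrict Z B) (restrict_closed Z B).

(* Z / (Z :&: B), that is Z / B when B is contained in Z. *)
Definition subquot {M : lmodType R} (Z B : submodClosed M) : lmodType R :=
  quotmod (restrict Z B).

End SubmoduleConstructions.

Arguments zero_submod {R} M.
Arguments restrict {R M} Z B.

Notation ideal R := (submodClosed R^o).

Definition ideal_pow {R : comNzRingType} (J : ideal R) (n : nat) : {pred R^o} :=
  span [set a : R^o | exists2 f : 'I_n -> R,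
                        (forall t, f t \in J) & a = \prod_(t < n) f t].

HB.instance Definition _ (R : comNzRingType) (J : ideal R) n :=
  GRing.SubmodClosed.copy (ideal_pow J n) (span _).

(* The functor Gamma_J of J-power torsion. *)
Section Torsion.
Context {R : comNzRingType} (J : ideal R).

Definition torsion (M : lmodType R) : {pred M} :=
  [pred v | `[< exists n, forall a, a \in ideal_pow J n -> (a : R) *: v = 0 >]].
Arguments torsion M : clear implicits.

Lemma ideal_pow_leq n m a : (n <= m)%N ->
  a \in ideal_pow J m -> a \in ideal_pow J n.
Proof.
move=> nm /asboolP; apply=> _ [f fJ ->]; rewrite /= -(subnKC nm) in f fJ *.
rewrite big_split_ord /= mulrC; apply: (@rpredZ R R^o (ideal_pow J n)).
by apply/asboolP => N; apply; exists (fun t => f (lshift _ t)).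
Qed.

Lemma torsion_closed M : submod_closed (torsion M).
Proof.
split=> [|a u v /asboolP[n un] /asboolP[m vm]]; apply/asboolP.
  by exists 0%N => a _; rewrite scaler0.
exists (maxn n m) => b bJ; rewrite scalerDr scalerA mulrC -scalerA.
rewrite un ?vm ?scaler0 ?addr0//.
  exact: (ideal_pow_leq (leq_maxr n m)).
exact: (ideal_pow_leq (leq_maxl n m)).
Qed.
HB.instance Definition _ M := GRing.isSubmodClosed.Build R M (torsion M)
  (torsion_closed M).

Context {A B : lmodType R} (f : {linear A -> B}).

Lemma torsion_map_subproof (v : submod (torsion A)) :
  f (submod_val v) \in torsion B.
Proof.
have /asboolP[n vn] := submod_valP v; apply/asboolP; exists n => a aJ.
by rewrite -linearZ vn ?raddf0.
Qed.

Definition torsion_map (v : submod (torsion A)) : submod (torsion B) :=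
  Submod (torsion_map_subproof v).

Lemma torsion_map_linear : linear torsion_map.
Proof.
move=> a u v; apply: val_inj.
by rewrite /= !linearP.
Qed.
HB.instance Definition _ := GRing.isLinear.Build R _ _ *:%R torsion_map
  torsion_map_linear.

End Torsion.

Arguments torsion {R} J M.

Definition injective_module {R : comNzRingType} (E : lmodType R) : Prop :=
  forall (A B : lmodType R) (f : {linear A -> B}) (g : {linear A -> E}),
    injective f -> exists h : {linear B -> E}, forall a, h (f a) = g a.

(* An exact sequence 0 -> M -> E^0 -> E^1 -> ... with all E^n injective. *)
Record injective_resolution {R : comNzRingType} (M : lmodType R) := {
  res_obj : nat -> lmodType R;
  res_diff : forall n, {linear res_obj n -> res_obj n.+1};
  res_aug : {linear M -> res_obj 0};
  res_injective : forall n, injective_module (res_obj n);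
  res_aug_inj : injective res_aug;
  res_exact0 : kernel (res_diff 0) =i image_of res_aug;
  res_exact : forall n, kernel (res_diff n.+1) =i image_of (res_diff n)
}.

(* H^i_J(M), the i-th right derived functor of Gamma_J at M, computed as the
   i-th cohomology of Gamma_J(E) for an injective resolution E of M. *)
Section LocalCohomology.
Context {R : comNzRingType} (J : ideal R) {M : lmodType R}.
Context (E : injective_resolution M).

Definition torsion_obj (n : nat) : lmodType R := submod (torsion J (res_obj E n)).

Definition torsion_diff (n : nat) : {linear torsion_obj n -> torsion_obj n.+1} :=
  torsion_map (J := J) (res_diff E n).

Definition coboundaries (n : nat) : submodClosed (torsion_obj n) :=
  match n with
  | 0 => zero_submod (torsion_obj 0)
  | n'.+1 => image_of (torsion_diff n')
  end.

Definition local_cohomology (i : nat) : lmodType R :=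
  subquot (kernel (torsion_diff i)) (coboundaries i).

End LocalCohomology.

Definition submod_lt {R : comNzRingType} {M : lmodType R}
    (N P : submodClosed M) : Prop :=
  {subset N <= P} /\ ~ {subset P <= N}.

(* The length is the supremum of the lengths of strict chains of submodules. *)
Definition finite_length {R : comNzRingType} (M : lmodType R) : Prop :=
  exists n : nat, forall (l : nat) (N : nat -> submodClosed M),
    (forall j, (j < l)%N -> submod_lt (N j) (N j.+1)) -> (l <= n)%N.

Section RingTheory.
Context (R : comNzRingType).

Definition noetherian : Prop :=
  forall J : ideal R, exists s : seq R, J =i span [set a : R^o | a \in s].

Definition maximal_ideal (m : ideal R) : Prop :=
  1 \notin m /\
  forall J : ideal R, 1 \notin J -> {subset m <= J} -> {subset J <= m}.

Definition local_ring (m : ideal R) : Prop :=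
  maximal_ideal m /\ forall m' : ideal R, maximal_ideal m' -> m' =i m.

Definition residue_map (m : ideal R) (k : fieldType) (pi : {rmorphism R -> k}) :
    Prop :=
  (forall c, exists r, pi r = c) /\ forall r, (pi r == 0) = (r \in m).

Definition prime_ideal (P : ideal R) : Prop :=
  1 \notin P /\ prime_idealr_closed (P : {pred R}).

Definition prime_chain (l : nat) (P : nat -> ideal R) : Prop :=
  (forall j, (j <= l)%N -> prime_ideal (P j)) /\
  forall j, (j < l)%N -> submod_lt (P j) (P j.+1).

Definition krull_dim (d : nat) : Prop :=
  (exists P, prime_chain d P) /\ forall l P, prime_chain l P -> (l <= d)%N.

Definition regular_sequence (s : seq R) : Prop :=
  1 \notin span [set a : R^o | a \in s] /\
  forall j, (j < size s)%N ->
    forall r : R, s`_j * r \in span [set a : R^o | a \in take j s] ->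
      r \in span [set a : R^o | a \in take j s].

Definition depth (m : ideal R) (n : nat) : Prop :=
  (exists s : seq R,
     [/\ size s = n, {subset s <= m} & regular_sequence s]) /\
  forall s : seq R, {subset s <= m} -> regular_sequence s -> (size s <= n)%N.

Definition cohen_macaulay (m : ideal R) : Prop :=
  exists2 n, krull_dim n & depth m n.

(* For a local ring (R, m) of dimension d: the ideal (x_1, ..., x_d) is
   m-primary, i.e. its radical is m. *)
Definition system_of_parameters (m : ideal R) (d : nat) (x : 'I_d -> R) : Prop :=
  krull_dim d /\
  forall r : R, (r \in m) <-> exists n, r ^+ n \in span (range x : set R^o).

Definition squarefree_monomial_ideal (d : nat) (x : 'I_d -> R) (I : ideal R) :
    Prop :=
  exists S : {set {set 'I_d}},
    I =i span [set a : R^o | exists2 A, A \in S & a = \prod_(j in A) x j].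

End RingTheory.

(* Main.v *)
(* Let A_a be the subsets of {1, ..., d} such that I is generated by the monomials
   x_(A_a), and let U(s) be the union of the A_a for a in s.  Since R is
   Cohen-Macaulay, the powers x_1^n, ..., x_d^n form a regular sequence in any
   order, so the Taylor complex of the monomials x_(A_a)^n resolves R modulo an ideal
   cofinal with the powers of I, and H^i_I(R) is the direct limit over n of the
   cohomology of the dual complexes.  Such a complex consists of free modules with
   basis the sets s, and it is filtered by monomials: the graded piece at
   N c {1, ..., d} is governed by the subcomplex K_N, over the field k, of the simplex
   cochains on the sets s with N c U(s).

   If K_N is exact in degree i for every N <> {1, ..., d}, every cocycle is
   cohomologous to one supported on the sets s with U(s) = {1, ..., d}, which becomes
   divisible by y = x_1 ... x_d at the next level of the limit; hence y acts
   surjectively.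

   Otherwise some N <> {1, ..., d} carries a cycle phi and a cocycle zeta of K_N over
   k with <phi, zeta> = 1.  By balancing Tor, H^(d - i)_m(R / I) is the direct limit of
   the modules H_i(T / (x_1^n, ..., x_d^n) T), T being the Taylor complex of I.  For j
   not in N, multiplying the coefficients of phi by monomials with a large negative
   degree in x_j gives classes which x_j^t does not kill: pairing with zeta, their
   vanishing would give (x_1 ... x_d)^(n - 1) in (x_1^n, ..., x_d^n).  But a power of
   x_j kills a torsion module of finite length.  For i > d the same class contradicts
   the vanishing of Tor_i. *)

From HB Require Import structures.
Require Import Defs.
From mathcomp Require Import all_boot all_order all_algebra.
From mathcomp Require Import boolp classical_sets.
From mathcomp Require Import fintype finset ring zify.
(* Restores [span], shadowed by the span of vector spaces. *)
Import Defs.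

Set Implicit Arguments.
Unset Strict Implicit.
Unset Printing Implicit Defensive.

Import GRing.Theory.
Local Open Scope ring_scope.

(** * Ideals in noetherian local rings *)

Section Submodules.
Context {R : comNzRingType}.
Implicit Types M : lmodType R.

(** The ring has no grading by monomials, so the graded pieces are replaced by colon ideals: for
    square-free monomials in a permutable regular sequence, colons by monomials are the same as in a
    polynomial ring ([colon_smon]), and one multidegree at a time can be split off. The field enters
    through finite matrices only: either a contraction or a pairing is found over k and carried to R
    by [iota].

    No direct limit is formed and no derived functors are compared. A torsion element is killed by a
    power of the ideal, so a class is seen at some finite exponent n, and so is a reason for its
    vanishing; [zigzag] and [balanced] transport single elements through double complexes. The
    powers of x must therefore be permutable regular sequences at every positive exponent, whereas
    Cohen-Macaulayness provides a single regular sequence of length d. The passage goes through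
    depth sensitivity of the Koszul complex, which treats one variable modulo all the others, and
    Krull's intersection theorem, which then drops the other variables. *)

Definition submod_of M (P : {pred M}) (cP : submod_closed P) : submodClosed M :=
  HB.pack_for (submodClosed M) P (GRing.isSubmodClosed.Build R M P cP).

Definition lincomb M (J : finType) (P : pred J) (g : J -> M) : {pred M} :=
  [pred v | `[< exists f : J -> R, v = \sum_(j | P j) f j *: g j >]].

Lemma lincomb_closed M (J : finType) (P : pred J) (g : J -> M) :
  submod_closed (lincomb P g).
Proof.
split=> [|a u v /asboolP[f ->] /asboolP[f' ->]]; apply/asboolP.
  by exists (fun=> 0); rewrite big1// => j _; rewrite scale0r.
exists (fun j => a * f j + f' j); rewrite scaler_sumr -big_split/=.
by apply: eq_bigr => j _; rewrite scalerDl scalerA.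
Qed.
HB.instance Definition _ M (J : finType) (P : pred J) (g : J -> M) :=
  GRing.isSubmodClosed.Build R M (lincomb P g) (lincomb_closed P g).

Lemma lincombP M (J : finType) (P : pred J) (g : J -> M) v :
  reflect (exists f : J -> R, v = \sum_(j | P j) f j *: g j) (v \in lincomb P g).
Proof. exact: asboolP. Qed.

Lemma mem_lincomb M (J : finType) (P : pred J) (g : J -> M) j :
  P j -> g j \in lincomb P g.
Proof.
move=> Pj; apply/lincombP; exists (fun i => (i == j)%:R).
rewrite (bigD1 j)//= eqxx scale1r big1 ?addr0// => i /andP[_ /negPf->].
by rewrite scale0r.
Qed.

Lemma lincomb_sub M (J : finType) (P : pred J) (g : J -> M) (N : submodClosed M) :
  (forall j, P j -> g j \in N) -> {subset lincomb P g <= N}.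
Proof.
by move=> gN _ /lincombP[f ->]; apply: rpred_sum => j /gN; apply: rpredZ.
Qed.

Lemma mem_span M (S : set M) v : S v -> v \in span S.
Proof. by move=> Sv; apply/asboolP => N; apply. Qed.

Lemma span_sub M (S : set M) (N : submodClosed M) :
  (forall v, S v -> v \in N) -> {subset span S <= N}.
Proof. by move=> SN v /asboolP; apply. Qed.

End Submodules.

Section Ideals.
Context {R : comNzRingType}.

Lemma ideal_mull (J : ideal R) (a b : R) : b \in J -> a * b \in J.
Proof. exact: (@rpredZ R R^o J). Qed.

Lemma ideal_mulr (J : ideal R) (a b : R) : a \in J -> a * b \in J.
Proof. by rewrite mulrC; apply: ideal_mull. Qed.

(* The closure properties restated over [R]: rewriting does not see through
   [R^o]. *)
Lemma ideal0 (J : ideal R) : (0 : R) \in J.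
Proof. exact: (@rpred0 R^o J). Qed.

Lemma idealD (J : ideal R) (a b : R) : a \in J -> b \in J -> a + b \in J.
Proof. exact: (@rpredD R^o J). Qed.

Lemma idealN (J : ideal R) (a : R) : a \in J -> - a \in J.
Proof. by move=> aJ; rewrite -mulN1r ideal_mull. Qed.

Lemma idealB (J : ideal R) (a b : R) : a \in J -> b \in J -> a - b \in J.
Proof. by move=> aJ bJ; apply/idealD/idealN. Qed.

Lemma ideal_sum (J : ideal R) (T : finType) (P : pred T) (f : T -> R) :
  (forall t, P t -> f t \in J) -> \sum_(t | P t) f t \in J.
Proof. exact: (@rpred_sum R^o J). Qed.

Definition gen (J : finType) (P : pred J) (g : J -> R) : ideal R :=
  lincomb P (g : J -> R^o).

Lemma genP (J : finType) (P : pred J) (g : J -> R) (r : R) :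
  reflect (exists f : J -> R, r = \sum_(j | P j) f j * g j) (r \in gen P g).
Proof. exact: asboolP. Qed.

Lemma mem_gen (J : finType) (P : pred J) (g : J -> R) j (r : R) :
  P j -> r = g j -> r \in gen P g.
Proof. by move=> Pj ->; exact: (@mem_lincomb _ R^o _ P g). Qed.

Lemma gen_sub (J : finType) (P : pred J) (g : J -> R) (N : ideal R) :
  (forall j, P j -> g j \in N) -> {subset gen P g <= N}.
Proof. exact: (@lincomb_sub _ R^o). Qed.

Lemma noetherian_acc (J : nat -> ideal R) : noetherian R ->
  (forall n, {subset J n <= J n.+1}) -> exists n, {subset J n.+1 <= J n}.
Proof.
move=> nR incJ.
have monoJ i j : (i <= j)%N -> {subset J i <= J j}.
  move=> /subnK <-; elim: (j - i)%N => [|l IH] a aJ //.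
  by rewrite addSn; apply/incJ/IH.
pose U : {pred R^o} := [pred a | `[< exists n, a \in J n >]].
have cU : submod_closed U.
  split=> [|a u v /asboolP[p up] /asboolP[q vq]]; apply/asboolP.
    by exists 0%N; rewrite rpred0.
  exists (maxn p q); rewrite rpredD ?rpredZ//.
    by apply: monoJ up; rewrite leq_maxl.
  by apply: monoJ vq; rewrite leq_maxr.
have [s sU] := nR (submod_of cU).
have [n sn] : exists n, forall a, a \in s -> a \in J n.
  have : forall a, a \in s -> a \in submod_of cU.
    by move=> a as_; rewrite sU mem_span.
  elim: {sU}s => [|a s IH] sU; first by exists 0%N.
  have [p ps] : exists n, forall a, a \in s -> a \in J n.
    by apply: IH => b bs; apply: sU; rewrite inE bs orbT.
  have /asboolP[q aq] : a \in U by apply: sU; rewrite inE eqxx.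
  exists (maxn p q) => b; rewrite inE => /orP[/eqP->|/ps].
    by apply: monoJ aq; rewrite leq_maxr.
  by apply: monoJ; rewrite leq_maxl.
exists n => a an.
have : a \in submod_of cU by apply/asboolP; exists n.+1.
by rewrite sU; apply: span_sub.
Qed.

(** A maximal ideal above a non-unit is obtained without Zorn: if no ideal containing r but not 1
    were maximal, choice would iterate to a strictly increasing chain. *)
Lemma local_unit (m : ideal R) (r : R) :
  noetherian R -> local_ring m -> r \notin m -> exists s, s * r = 1.
Proof.
move=> nR [_ mU] rm; apply: contrapT => nunit.
pose P (J : ideal R) := 1 \notin J /\ r \in J.
have step (J : {J : ideal R | P J}) :
    exists J' : {J : ideal R | P J}, submod_lt (sval J) (sval J').
  case: J => J [J1 Jr]; apply: contrapT => nJ.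
  have Jmax : maximal_ideal J.
    split=> // J' J'1 JJ' a aJ'; apply: contrapT => aJ; apply: nJ.
    have PJ' : P J' by split=> //; apply: JJ'.
    by exists (exist _ J' PJ'); split=> //= J'J; apply/aJ/J'J.
  by move: rm; rewrite -(mU _ Jmax) Jr.
have [f fP] := choice step.
have cr : submod_closed ([pred a : R^o | `[< exists s, a = s * r >]] : {pred R^o}).
  split=> [|a u v /asboolP[u' ->] /asboolP[v' ->]]; apply/asboolP.
    by exists 0; rewrite mul0r.
  by exists (a * u' + v'); rewrite mulrDl -mulrA.
have P0 : P (submod_of cr).
  split; first by apply/asboolP => -[s sr]; apply: nunit; exists s.
  by apply/asboolP; exists 1; rewrite mul1r.
pose J n := sval (iter n f (exist _ _ P0)).
have [//|n Jn] := @noetherian_acc J nR; first by move=> n; case: (fP (iter n f (exist _ _ P0))).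
by case: (fP (iter n f (exist _ _ P0))) => _; apply.
Qed.

Lemma local_unitB (m : ideal R) (a y : R) :
  noetherian R -> local_ring m -> y \in m -> exists s, s * (1 - a * y) = 1.
Proof.
move=> nR lm ym; apply: (local_unit nR lm); have [[m1 _] _] := lm.
apply: contra m1 => aym; rewrite -[1](subrK (a * y)) idealD//.
exact: ideal_mull.
Qed.

Lemma colon_closed (Q : ideal R) (y : R) :
  submod_closed ([pred r | y * r \in Q] : {pred R^o}).
Proof.
split=> [|a u v]; rewrite !inE; first by rewrite mulr0; exact: ideal0.
move=> uQ vQ; rewrite mulrDr idealD// [a *: u](_ : _ = u * a) ?mulrA.
  exact: ideal_mulr.
exact: mulrC.
Qed.

Definition colon (Q : ideal R) (y : R) : ideal R := submod_of (colon_closed Q y).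

Lemma colonE (Q : ideal R) (y r : R) : (r \in colon Q y) = (y * r \in Q).
Proof. by []. Qed.

Lemma add_principal_closed (Q : ideal R) (c : R) :
  submod_closed ([pred r | `[< exists a, r - a * c \in Q >]] : {pred R^o}).
Proof.
split=> [|a u v /asboolP[u' uQ] /asboolP[v' vQ]]; apply/asboolP.
  by exists 0; rewrite mul0r subr0 ideal0.
exists (a * u' + v'); rewrite mulrDl opprD addrACA idealD//.
by rewrite -mulrA -[a *: u]/(a * u) -mulrBr ideal_mull.
Qed.

Definition add_principal (Q : ideal R) (c : R) : ideal R :=
  submod_of (add_principal_closed Q c).

Lemma add_principalP (Q : ideal R) (c r : R) :
  reflect (exists a, r - a * c \in Q) (r \in add_principal Q c).
Proof. exact: asboolP. Qed.

(** Krull's intersection theorem in R / Q. Write r = c_n y^n modulo Q and let (Q : y^n) be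
    stationary; it then contains c_(n+p) - c_(n+p+1) y for all p. So the ideals (Q : y^n) +
    (c_(n+p)) increase; where they stop, c_(n+p+1) = a y c_(n+p+1) modulo (Q : y^n), and 1 - a y is
    a unit. *)
Lemma krull_principal (m Q : ideal R) (y r : R) :
  noetherian R -> local_ring m -> y \in m ->
  (forall n, r \in add_principal Q (y ^+ n)) -> r \in Q.
Proof.
move=> nR lm ym rQ.
have /choice[c rc] n : exists a, r - a * y ^+ n \in Q.
  exact/add_principalP/rQ.
have [|n Qn] := @noetherian_acc (fun n => colon Q (y ^+ n)) nR.
  by move=> n a; rewrite !colonE exprS -mulrA; apply: ideal_mull.
have {}Qn p a : a \in colon Q (y ^+ (n + p)) -> a \in colon Q (y ^+ n).
  elim: p a => [|p IH] a; first by rewrite addn0.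
  rewrite addnS colonE exprSr -mulrA -colonE => /IH ya.
  by apply: Qn; rewrite colonE exprSr -mulrA.
have cS p : c (n + p)%N - c (n + p).+1 * y \in colon Q (y ^+ n).
  apply: (Qn p); rewrite colonE.
  have := idealB (rc (n + p).+1) (rc (n + p)%N); rewrite exprS.
  by congr (_ \in Q); ring.
have [|p Jp] := @noetherian_acc (fun p => add_principal (colon Q (y ^+ n)) (c (n + p)%N)) nR.
  move=> p a /add_principalP[b ab]; apply/add_principalP; exists (b * y).
  rewrite -(subrKA (b * c (n + p)%N)) idealD// -!mulrA -mulrBr ideal_mull//.
  by rewrite addnS mulrC cS.
have /Jp/add_principalP[a ca] :
    c (n + p.+1)%N \in add_principal (colon Q (y ^+ n)) (c (n + p.+1)%N).
  by apply/add_principalP; exists 1; rewrite mul1r subrr ideal0.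
have [s s1] := local_unitB a nR lm ym.
have cQ : c (n + p).+1 \in colon Q (y ^+ n).
  rewrite -[c _]mul1r -s1 -mulrA ideal_mull// mulrBl mul1r.
  rewrite -(subrKA (a * c (n + p)%N)) idealD//; first by rewrite -addnS.
  by rewrite -mulrA -mulrBr ideal_mull// mulrC cS.
rewrite -(subrK (c (n + p).+1 * y ^+ (n + p).+1) r); apply: idealD => //.
by rewrite -addnS in cQ *; rewrite exprD mulrA ideal_mulr// mulrC -colonE.
Qed.

End Ideals.

(** * Incidence signs of the simplex *)

Section Simplex.
Context {R : comNzRingType} {s : nat}.
Implicit Types (M : lmodType R) (sg tau rho : {set 'I_s}) (a b : 'I_s).

Definition sgn sg a : R := (-1) ^+ #|[set b in sg | (b < a)%N]|.

Definition incid sg tau : R := \sum_(a in sg) (tau == sg :\ a)%:R * sgn sg a.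

(** Exterior multiplication by the basis vector e_a, on coefficients; [int_op] is the contraction
    with its dual vector. *)
Definition ext_op a M (f : {set 'I_s} -> M) sg : M :=
  if a \in sg then sgn sg a *: f (sg :\ a) else 0.

Definition int_op a M (f : {set 'I_s} -> M) sg : M :=
  if a \in sg then 0 else sgn (a |: sg) a *: f (a |: sg).

Lemma sgn_sq sg a : sgn sg a * sgn sg a = 1.
Proof. by rewrite -expr2 sqrr_sign. Qed.

Lemma sgnD1_lt sg a b : (a < b)%N -> sgn (sg :\ b) a = sgn sg a.
Proof.
move=> ab; rewrite /sgn; congr (_ ^+ _); apply: eq_card => c; rewrite !inE.
by case: (c =P b) => [->|//]; rewrite ltnNge (ltnW ab) !andbF.
Qed.

Lemma sgnD1_gt sg a b : (a < b)%N -> a \in sg -> sgn (sg :\ a) b = - sgn sg b.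
Proof.
move=> ab asg; rewrite /sgn (cardsD1 a [set c in sg | _]) !inE asg ab/=.
rewrite add1n exprS mulN1r opprK; congr (_ ^+ _).
by apply: eq_card => c; rewrite !inE andbA.
Qed.

Lemma sgnD1_anti sg a b : a != b -> a \in sg -> b \in sg ->
  sgn (sg :\ b) a * sgn (sg :\ a) b = - (sgn sg a * sgn sg b).
Proof.
move=> ab asg bsg; have [lab|lba] : (a < b)%N \/ (b < a)%N.
  by apply/orP; rewrite -neq_ltn.
- by rewrite sgnD1_lt// sgnD1_gt// mulrN.
- by rewrite sgnD1_gt// [sgn (_ :\ a) _]sgnD1_lt// mulNr.
Qed.

Lemma sgnD1_swap sg a b : a != b -> a \in sg -> b \in sg ->
  sgn sg a * sgn (sg :\ a) b = - (sgn sg b * sgn (sg :\ b) a).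
Proof.
move=> ab asg bsg; have [lab|lba] : (a < b)%N \/ (b < a)%N.
  by apply/orP; rewrite -neq_ltn.
- by rewrite sgnD1_gt// [sgn (_ :\ b) _]sgnD1_lt// mulrN mulrC.
- by rewrite sgnD1_lt// [sgn (_ :\ b) _]sgnD1_gt// mulrN opprK mulrC.
Qed.

(** The Clifford relation, from which both [incid_contraction] and [koszul_contraction] follow. *)
Lemma ext_int_op a b M (f : {set 'I_s} -> M) sg :
  ext_op a (int_op b f) sg + int_op b (ext_op a f) sg = (a == b)%:R *: f sg.
Proof.
rewrite /ext_op /int_op; case: (altP (a =P b)) => [<-|ab].
  rewrite !inE eqxx/= scale1r; case: ifP => asg; last first.
    by rewrite setU1K ?asg// add0r scalerA sgn_sq scale1r.
  by rewrite setD1K// addr0 scalerA sgn_sq scale1r.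
rewrite scale0r !inE (negPf ab)/= eq_sym (negPf ab)/=.
case: ifP => asg; case: ifP => bsg; rewrite ?scaler0 ?addr0//.
have bsg' : b \notin sg by rewrite bsg.
rewrite !scalerA [b |: sg :\ a](_ : _ = (b |: sg) :\ a).
  rewrite -{1}[sg](setU1K bsg') sgnD1_anti ?inE ?eqxx ?asg ?orbT//.
  by rewrite [sgn _ b * _]mulrC -scalerDl addNr scale0r.
by apply/setP => c; rewrite !inE; case: (c =P b) => [->|//]; rewrite eq_sym ab.
Qed.

Lemma ext_op_anti a b M (f : {set 'I_s} -> M) sg :
  a != b -> ext_op a (ext_op b f) sg = - ext_op b (ext_op a f) sg.
Proof.
move=> ab; rewrite /ext_op !inE ab/= eq_sym ab/=.
case: ifP => asg; case: ifP => bsg; rewrite ?scaler0 ?oppr0//.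
rewrite !scalerA sgnD1_swap// scaleNr; congr (- (_ *: f _)).
by apply/setP => c; rewrite !inE andbCA.
Qed.

Lemma ext_op_sq a M (f : {set 'I_s} -> M) sg : ext_op a (ext_op a f) sg = 0.
Proof. by rewrite /ext_op !inE eqxx/= scaler0; case: ifP. Qed.

(** The diagonal needs its own hypothesis, since 2 may fail to be regular on M. *)
Lemma alternating_sum M (F : 'I_s -> 'I_s -> M) :
  (forall a, F a a = 0) -> (forall a b, a != b -> F a b = - F b a) ->
  \sum_a \sum_b F a b = 0.
Proof.
move=> F0 FN; rewrite pair_big/= (bigID (fun p : 'I_s * 'I_s => (p.1 < p.2)%N))/=.
rewrite [X in _ + X](bigID (fun p : 'I_s * 'I_s => p.1 == p.2))/=.
rewrite [X in _ + (X + _)]big1 ?add0r; last first.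
  by move=> [a b]/= /andP[_ /eqP->].
have swapK : involutive (fun p : 'I_s * 'I_s => (p.2, p.1)) by case.
rewrite (reindex_inj (inv_inj swapK))/=.
rewrite [X in X + _](eq_bigr (fun p : 'I_s * 'I_s => - F p.1 p.2)); last first.
  by move=> [a b]/= ba; rewrite FN// eq_sym neq_ltn ba orbT.
rewrite sumrN [X in - X + _](eq_bigl (fun p : 'I_s * 'I_s =>
  ~~ (p.1 < p.2)%N && (p.1 != p.2))) ?addNr//.
by move=> [a b]/=; rewrite -leqNgt ltn_neqAle eq_sym andbC.
Qed.

(** Rows of [incid] are indexed by the larger set, so [incid] acts as the coboundary and
    [transp incid] as the boundary. *)
Definition act (X Y : finType) M (D : X -> Y -> R) (f : Y -> M) (t : X) : M :=
  \sum_(y : Y) D t y *: f y.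

Definition transp (X Y : Type) (D : X -> Y -> R) (y : Y) (t : X) := D t y.

Lemma act_incid M (f : {set 'I_s} -> M) sg : act incid f sg = \sum_a ext_op a f sg.
Proof.
rewrite /act /incid /ext_op -big_mkcond/=.
under eq_bigr do rewrite scaler_suml.
rewrite exchange_big/=; apply: eq_bigr => a asg.
rewrite (bigD1 (sg :\ a))//= eqxx mul1r big1 ?addr0// => t /negPf->.
by rewrite mul0r scale0r.
Qed.

Lemma act_incidT M (f : {set 'I_s} -> M) tau :
  act (transp incid) f tau = \sum_a int_op a f tau.
Proof.
rewrite /act /transp /incid /int_op.
under eq_bigr do rewrite scaler_suml.
rewrite pair_big_dep/= [RHS](eq_bigr (fun a =>
  if a \notin tau then sgn (a |: tau) a *: f (a |: tau) else 0)); last first.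
  by move=> a _; rewrite if_neg.
rewrite -big_mkcond/=.
rewrite (bigID (fun p : {set 'I_s} * 'I_s => (p.2 \notin tau) && (p.1 == p.2 |: tau)))/=.
rewrite [X in _ + X]big1 ?addr0; last first.
  move=> [sg a]/= /andP[asg nsg]; rewrite [tau == _](_ : _ = false) ?mul0r ?scale0r//.
  apply: contraNF nsg => /eqP->; rewrite setD1K// eqxx.
  by rewrite !inE eqxx.
rewrite (reindex (fun a => (a |: tau, a)))/=; last first.
  exists snd => [//|[sg a]/=]; rewrite inE/= => /andP[_ /andP[_ /eqP->]]//.
apply: eq_big => [a|a]; first by rewrite setU11 eqxx !andbT.
by rewrite setU11 eqxx andbT => an; rewrite setU1K// eqxx mul1r.
Qed.

Lemma incid_sub sg tau : incid sg tau != 0 -> (tau \subset sg) && (#|sg| == #|tau|.+1).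
Proof.
apply: contraNT => nst; apply/eqP/big1 => a asg.
case: eqP => [t|]; last by rewrite mul0r.
by rewrite t subsetDl/= (cardsD1 a) asg eqxx in nst.
Qed.

Lemma incid_comp sg rho : \sum_tau incid sg tau * incid tau rho = 0.
Proof.
pose f tau : R^o := (tau == rho)%:R.
have fE tau : act incid f tau = incid tau rho.
  rewrite /act (bigD1 rho)//= /f eqxx big1 => [|i /negPf->]; last by rewrite scaler0.
  by rewrite addr0 [_ *: _]mulr1.
transitivity (act incid (act incid f) sg); first by apply: eq_bigr => t _; rewrite fE.
rewrite (@act_incid R^o) -[RHS](@alternating_sum R^o (fun a b => ext_op a (ext_op b f) sg)).
- apply: eq_bigr => a _; rewrite {1}/ext_op; under [RHS]eq_bigr do rewrite {1}/ext_op.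
  by case: ifP => asg; [rewrite (@act_incid R^o) scaler_sumr|rewrite big1].
- by move=> a; apply: ext_op_sq.
- by move=> a b; apply: ext_op_anti.
Qed.

Lemma incid_set1 a : incid [set a] set0 = 1.
Proof.
rewrite /incid big_set1 setDv eqxx mul1r /sgn.
rewrite [[set b in _ | _]](_ : _ = set0) ?cards0//; apply/setP => b.
by rewrite !inE; case: eqP => [->|//]; rewrite ltnn.
Qed.

Lemma incid_contraction a M (f : {set 'I_s} -> M) sg :
  act (transp incid) (ext_op a f) sg + ext_op a (act (transp incid) f) sg = f sg.
Proof.
rewrite act_incidT [ext_op a _ _](_ : _ = \sum_b ext_op a (int_op b f) sg).
  rewrite -big_split/= (bigD1 a)//= addrC big1 ?add0r => [|b ba].
    by rewrite addrC ext_int_op eqxx scale1r.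
  by rewrite addrC ext_int_op eq_sym (negPf ba) scale0r.
rewrite {1}/ext_op; under [RHS]eq_bigr do rewrite {1}/ext_op.
by case: ifP => asg; [rewrite act_incidT scaler_sumr|rewrite big1].
Qed.

End Simplex.

(** * Systems of parameters in Cohen-Macaulay rings *)

Section KoszulOps.
Context {R : comNzRingType} {d : nat} (y : 'I_d -> R).

Definition koszul (f : {set 'I_d} -> R) (F : {set 'I_d}) : R :=
  \sum_a y a * @ext_op R d a R^o f F.

Definition homog (T : zmodType) (p : nat) (f : {set 'I_d} -> T) :=
  forall F : {set 'I_d}, #|F| != p -> f F = 0.

Lemma ext_opE a f F :
  @ext_op R d a R^o f F = if a \in F then sgn F a * f (F :\ a) else 0.
Proof. by []. Qed.

Lemma koszulE f F : koszul f F = \sum_(a in F) y a * (sgn F a * f (F :\ a)).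
Proof.
rewrite [RHS]big_mkcond; apply: eq_bigr => a _; rewrite ext_opE.
by case: ifP; rewrite ?mulr0.
Qed.

Lemma koszul_lin (c : R) f g F :
  koszul (fun F => c * f F + g F) F = c * koszul f F + koszul g F.
Proof.
rewrite !koszulE mulr_sumr -big_split; apply: eq_bigr => a _ /=; ring.
Qed.

Lemma koszulB f g F : koszul (fun F => f F - g F) F = koszul f F - koszul g F.
Proof.
by rewrite !koszulE -sumrB; apply: eq_bigr => a _ /=; ring.
Qed.

Lemma koszul_ideal (Q : ideal R) f F : (forall F, f F \in Q) -> koszul f F \in Q.
Proof.
by move=> fQ; rewrite koszulE; apply: ideal_sum => a _; do 2!apply: ideal_mull.
Qed.

Lemma koszul_koszul f F : koszul (koszul f) F = 0.
Proof.
rewrite koszulE big_mkcond/=.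
rewrite -[RHS](@alternating_sum R d R^o (fun a b => y a * y b *
   @ext_op R d a R^o (@ext_op R d b R^o f) F)).
- apply: eq_bigr => a _; under [RHS]eq_bigr do rewrite ext_opE.
  case: ifP => _; last by rewrite big1// => b _; rewrite mulr0.
  by rewrite !mulr_sumr; apply: eq_bigr => b _; ring.
- by move=> a; rewrite (@ext_op_sq R d a R^o) mulr0.
- by move=> a b ab; rewrite (@ext_op_anti R d a b R^o)// mulrN [y a * y b]mulrC.
Qed.

(** Contraction with the covector c is a homotopy for multiplication by the sum of the c_a y_a;
    hence the ideal (y) annihilates Koszul cohomology. *)
Lemma koszul_contraction (c : 'I_d -> R) f F :
  (\sum_a c a * y a) * f F =
  koszul (fun F => \sum_b c b * @int_op R d b R^o f F) F +
  \sum_b c b * @int_op R d b R^o (koszul f) F.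
Proof.
have intE b g F' : @int_op R d b R^o g F' =
  if b \in F' then 0 else sgn (b |: F') b * g (b |: F') by [].
have -> : koszul (fun F => \sum_b c b * @int_op R d b R^o f F) F =
   \sum_a \sum_b y a * c b * @ext_op R d a R^o (@int_op R d b R^o f) F.
  rewrite koszulE big_mkcond/=; apply: eq_bigr => a _.
  under [RHS]eq_bigr do rewrite ext_opE.
  case: ifP => _; last by rewrite big1// => b _; rewrite mulr0.
  by rewrite !mulr_sumr; apply: eq_bigr => b _; ring.
have -> : \sum_b c b * @int_op R d b R^o (koszul f) F =
   \sum_a \sum_b y a * c b * @int_op R d b R^o (@ext_op R d a R^o f) F.
  rewrite exchange_big; apply: eq_bigr => b _ /=.
  rewrite intE; under [RHS]eq_bigr do rewrite intE.
  case: ifP => _; first by rewrite mulr0 big1// => a _; rewrite mulr0.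
  by rewrite !mulr_sumr; apply: eq_bigr => a _; ring.
rewrite -big_split/= mulr_suml; apply: eq_bigr => a _.
rewrite -big_split/= (bigD1 a)//= -mulrDr (@ext_int_op R d a a R^o) eqxx scale1r.
rewrite big1 ?addr0 => [|b ba]; first by rewrite [y a * c a]mulrC.
by rewrite -mulrDr (@ext_int_op R d a b R^o) eq_sym (negPf ba) scale0r mulr0.
Qed.

Lemma homog_int p (f : {set 'I_d} -> R^o) b : homog p f ->
  forall F : {set 'I_d}, #|F|.+1 != p -> @int_op R d b R^o f F = 0.
Proof.
move=> hf F Fp; rewrite /int_op; case: ifP => // bF; rewrite hf ?scaler0//.
by rewrite cardsU1 bF.
Qed.

End KoszulOps.

Lemma span_take (R : comNzRingType) (s : seq R) (t : nat) (r : R) :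
  (t < size s)%N -> r \in span [set a : R^o | a \in take t.+1 s]%classic ->
  exists a, r - s`_t * a \in span [set a : R^o | a \in take t s]%classic.
Proof.
move=> ts; rewrite (take_nth 0)// => rs.
have : r \in add_principal (span [set a : R^o | a \in take t s]%classic) s`_t.
  apply: span_sub rs => v /=; rewrite mem_rcons inE => /orP[/eqP->|vs].
    by apply/add_principalP; exists 1; rewrite mul1r subrr ideal0.
  by apply/add_principalP; exists 0; rewrite mul0r subr0; apply: mem_span.
by move=> /add_principalP[a ra]; exists a; rewrite mulrC.
Qed.

(** Cochains of degree d - 1 are d-tuples; the signs are chosen so that the differential is the
    plain linear form, which turns a linear relation among the y_a into a cocycle. *)
Lemma koszul_top (R : comNzRingType) (d : nat) (y c : 'I_d -> R) : (0 < d)%N ->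
  exists f : {set 'I_d} -> R, [/\ homog d.-1 (f : _ -> R^o),
    forall a, f (setT :\ a) = sgn setT a * c a &
    forall F, koszul y f F = if F == setT then \sum_a c a * y a else 0].
Proof.
move=> d0; pose f (F : {set 'I_d}) := \sum_a (F == setT :\ a)%:R * (sgn setT a * c a) : R.
have fE a : f (setT :\ a) = sgn setT a * c a.
  rewrite /f (bigD1 a)//= eqxx mul1r big1 ?addr0// => b ba.
  rewrite (_ : (_ == _) = false) ?mul0r//; apply/negbTE/eqP => /setP/(_ a).
  by rewrite !inE eqxx eq_sym ba.
exists f; split=> // [F Fd|F].
  rewrite /f big1// => a _; case: eqP => [Fa|_]; last by rewrite mul0r.
  case/negP: Fd; apply/eqP; have := cardsD1 a [set: 'I_d].
  by rewrite inE -Fa cardsT card_ord add1n => /(congr1 predn)/= <-.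
case: eqP => [->|/eqP FT]; rewrite koszulE.
  rewrite big_mkcond; apply: eq_bigr => a _.
  by rewrite in_setT fE [sgn _ _ * _]mulrA sgn_sq mul1r mulrC.
rewrite big1// => a aF; rewrite /f big1 ?mulr0// => b _.
case: eqP => [Fa|_]; last by rewrite mul0r.
case/negP: FT; rewrite eqEcard subsetT (cardsD1 a F) aF Fa.
by have := cardsD1 b [set: 'I_d]; rewrite in_setT => ->; exact: leqnn.
Qed.

(** * Depth sensitivity of the Koszul complex *)

Section DepthSensitivity.
Context {R : comNzRingType} {d : nat} (y : 'I_d -> R) (s : seq R).
Hypothesis s_reg : regular_sequence s.
Hypothesis s_rad : forall a, a \in s ->
  exists n, a ^+ n \in gen (fun=> true) y.
Local Notation Q t := (span [set a : R^o | a \in take t s]%classic).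
Local Notation koszul := (koszul y).

Lemma span_takeS t : {subset Q t <= Q t.+1}.
Proof.
move=> r; apply: span_sub => v /= vs; apply: mem_span => /=.
by move: vs; rewrite -{1}(take_takel s (leqnSn t)); apply: mem_take.
Qed.

Lemma mem_span_take t : (t < size s)%N -> s`_t \in Q t.+1.
Proof.
by move=> ts; apply: mem_span; rewrite /= (take_nth 0)// mem_rcons inE eqxx.
Qed.

(* The long exact sequence of [s`_t] on [R / (s_1, ..., s_t)] shows that [s`_t]
   acts injectively on cohomology, while one of its powers acts as 0. *)
Lemma koszul_exact_mod p t f : (p + t < size s)%N -> homog p f ->
  (forall F, koszul f F \in Q t) ->
  exists2 g, (forall F : {set 'I_d}, #|F|.+1 != p -> g F = 0) &
    forall F, f F - koszul g F \in Q t.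
Proof.
elim: p t f => [|p IH] t f pt hf df.
  exists (fun=> 0) => // F; rewrite (_ : koszul _ F = 0) ?subr0; last first.
    by rewrite koszulE big1// => a _; rewrite !mulr0.
  have ts : (t < size s)%N by rewrite add0n in pt.
  have [n /genP[c cn]] := s_rad (mem_nth 0 ts).
  have key : s`_t ^+ n * f F \in Q t.
    rewrite cn (koszul_contraction y c f F); apply: idealD.
      rewrite koszulE (_ : \sum_(a in F) _ = 0) ?ideal0// big1// => a aF.
      by rewrite big1 ?mulr0// => b _; rewrite (homog_int _ hf)// mulr0.
    apply: ideal_sum => b _; apply: ideal_mull; rewrite /int_op.
    by case: ifP => _; [exact: ideal0 | exact: ideal_mull].
  have [_ reg] := s_reg.
  elim: n {cn} key => [|n IHn]; first by rewrite mul1r.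
  by rewrite exprS -mulrA => /(reg _ ts)/IHn.
have ts : (t < size s)%N by apply: leq_ltn_trans pt; rewrite leq_addl.
(* Division by s_t: b is a cocycle modulo one more element of the sequence, so by induction b =
   koszul e + s_t h; then s_t kills c - koszul h modulo the previous elements and can be
   cancelled. *)
have step c b : homog p.+1 c -> homog p b ->
    (forall F, s`_t * c F - koszul b F \in Q t) ->
    exists2 g, homog p g & forall F, c F - koszul g F \in Q t.
  move=> hc hb cb.
  have [||e he be] := IH t.+1 b _ hb; first by rewrite addnS -addSn.
    move=> F; have := idealB (ideal_mulr (c F) (mem_span_take ts)) (span_takeS (cb F)).
    by rewrite subKr.
  have /choice[h hP] F : exists a,
      (b F - koszul e F - s`_t * a \in Q t) /\ (#|F| != p -> a = 0).
    case: (altP (#|F| =P p)) => [_|Fp].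
      by have [a aP] := span_take ts (be F); exists a.
    exists 0; split=> //; rewrite hb//.
    have -> : koszul e F = 0.
      rewrite koszulE big1// => a aF; rewrite he ?mulr0//.
      by apply: contra Fp => /eqP<-; rewrite (cardsD1 a) aF.
    by rewrite mulr0 !subr0 ideal0.
  exists h => [F /(proj2 (hP F))//|F]; have [_ reg] := s_reg; apply: (reg _ ts).
  have -> : s`_t * (c F - koszul h F) = (s`_t * c F - koszul b F) +
     (koszul b F - koszul (koszul e) F - s`_t * koszul h F).
    by rewrite koszul_koszul; ring.
  apply: idealD => //; rewrite -koszulB.
  have -> : koszul (fun F => b F - koszul e F) F - s`_t * koszul h F =
     koszul (fun F => - s`_t * h F + (b F - koszul e F)) F.
    by rewrite koszul_lin mulNr addrC.
  by apply: koszul_ideal => F'; rewrite mulNr addrC; case: (hP F').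
have [n /genP[c cn]] := s_rad (mem_nth 0 ts).
have : exists2 g, homog p g & forall F, s`_t ^+ n * f F - koszul g F \in Q t.
  exists (fun F => \sum_b c b * @int_op R d b R^o f F).
    move=> F Fp; rewrite big1// => b _; rewrite (homog_int b hf) ?mulr0//.
  move=> F; rewrite cn (koszul_contraction y c f F) addrAC subrr add0r.
  apply: ideal_sum => b _; apply: ideal_mull; rewrite /int_op.
  by case: ifP => _; [exact: ideal0 | exact: ideal_mull].
elim: n {cn} => [|n IHn] [g hg gP].
  by exists g => F; [rewrite eqSS => /hg | have := gP F; rewrite mul1r].
apply: IHn; apply: (step _ g) => //; first by move=> F Fp; rewrite hf ?mulr0.
by move=> F; rewrite mulrA -exprS.
Qed.

Lemma koszul_exact p f : (p < size s)%N -> homog p f -> koszul f =1 (fun=> 0) ->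
  exists2 g, (forall F : {set 'I_d}, #|F|.+1 != p -> g F = 0) & f =1 koszul g.
Proof.
move=> ps hf f0; have [||g hg fg] := @koszul_exact_mod p 0 f _ hf.
- by rewrite addn0.
- by move=> F; rewrite f0 ideal0.
exists g => // F; apply/eqP; rewrite -subr_eq0.
have : f F - koszul g F \in zero_submod R^o.
  by apply: span_sub (fg F) => v; rewrite /= take0 in_nil.
by rewrite inE.
Qed.

(** The relation y_j r = sum of the c_l y_l is a cocycle of degree d - 1 with j-th coefficient r, up
    to sign; it is a coboundary, and the j-th coefficient of a coboundary only involves the other
    y_l. *)
Lemma koszul_nzd j (r : R) : (d <= size s)%N ->
  y j * r \in gen (fun l => l != j) y ->
  r \in gen (fun l => l != j) y.
Proof.
move=> ds /genP[c cE].
pose h a := if a == j then r else - c a.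
have d0 : (0 < d)%N by case: (j) => a; case: (d).
have [f [hf fE fT]] := koszul_top y h d0.
have [||g hg fg] := @koszul_exact d.-1 f _ hf.
- by rewrite prednK.
- move=> F; rewrite fT; case: ifP => // _.
  rewrite (bigD1 j)//= /h eqxx mulrC cE -big_split big1// => a aj /=.
  by rewrite (negPf aj) mulNr addrN.
have : sgn setT j * f (setT :\ j) \in gen (fun l => l != j) y.
  rewrite fg koszulE; apply: ideal_mull; apply: ideal_sum => a.
  rewrite in_setD1 in_setT andbT => aj; apply: ideal_mulr.
  exact: (mem_gen (j := a)).
by rewrite fE mulrA sgn_sq mul1r /h eqxx.
Qed.

End DepthSensitivity.

(** Regularity in every order, without the condition that the ideal be proper. *)
Definition perm_regular (R : comNzRingType) (d : nat) (u : 'I_d -> R) :=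
  forall (L : {set 'I_d}) j r, j \notin L ->
    u j * r \in gen (mem L) u ->
    r \in gen (mem L) u.

(** One exponent is raised at a time: r^n - c_l g_l lies in the ideal of the other generators, and
    it divides (r^n)^(a l) - (c_l g_l)^(a l). *)
Lemma lincomb_exp (R : comNzRingType) (J : finType) (g : J -> R)
    (a : J -> nat) (r : R) :
  (exists n, r ^+ n \in gen (fun=> true) g) ->
  exists n, r ^+ n \in gen (fun=> true) (fun j => g j ^+ a j).
Proof.
pose b (T : seq J) j := if j \in T then a j else 1%N.
suff key (T : seq J) : uniq T ->
    (exists n, r ^+ n \in gen (fun=> true) g) ->
    exists n, r ^+ n \in gen (fun=> true) (fun j => g j ^+ b T j).
  move=> /(key _ (enum_uniq J))[n rn]; exists n.
  by apply: gen_sub rn => j _; rewrite /b mem_enum;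
    apply: (mem_gen (j := j)).
have bE (U : seq J) j : g j ^+ b U j \in gen (fun=> true) (fun j => g j ^+ b U j).
  exact: (mem_gen (j := j)).
elim: T => [|l T IH] /=.
  by move=> _ [n rn]; exists n; apply: gen_sub rn => j _; have := bE [::] j.
move=> /andP[lT /IH{}IH] /IH[n /genP[c cE]].
exists (n * a l)%N; rewrite exprM.
rewrite -(subrK ((c l * g l) ^+ a l) (_ ^+ a l)); apply: idealD; last first.
  rewrite exprMn; apply: ideal_mull; have := bE (l :: T) l.
  by rewrite /b mem_head.
rewrite subrXX; apply: ideal_mulr; rewrite cE (bigD1 l)//= {1}/b (negPf lT) expr1.
rewrite addrAC subrr add0r; apply: ideal_sum => j jl; apply: ideal_mull.
by have := bE (l :: T) j; rewrite {1}/b in_cons (negPf jl).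
Qed.

Section SystemOfParameters.
Context {R : comNzRingType} (m : ideal R) {d : nat} (x : 'I_d -> R).
Hypothesis nR : noetherian R.
Hypothesis lm : local_ring m.
Hypothesis depth_d : depth m d.
Hypothesis x_sop : system_of_parameters m x.

Lemma span_range r : r \in span (range x : set R^o) ->
  r \in gen (fun=> true) x.
Proof.
apply: span_sub => _ [j _ <-].
exact: (mem_gen (j := j)).
Qed.

Lemma sop_mem j : x j \in m.
Proof.
by have [_ ->] := x_sop; exists 1%N; rewrite expr1; apply: mem_span; exists j.
Qed.

Lemma sop_unit : 1 \notin gen (fun=> true) x.
Proof.
have [[m1 _] _] := lm; apply: contra m1.
by apply: gen_sub => j _; apply: sop_mem.
Qed.

Lemma sop_exp (a : 'I_d -> nat) r : r \in m ->
  exists n, r ^+ n \in gen (fun=> true) (fun j => x j ^+ a j).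
Proof.
have [_ xm] := x_sop; move=> /xm[n rn]; apply: lincomb_exp.
by exists n; apply: span_range.
Qed.

Lemma koszul_sop_exact (a : 'I_d -> nat) p (f : {set 'I_d} -> R) : (p < d)%N ->
  homog p (f : {set 'I_d} -> R^o) ->
  koszul (fun j => x j ^+ a j) f =1 (fun=> 0) ->
  exists2 g, (forall F : {set 'I_d}, #|F|.+1 != p -> g F = 0) &
    f =1 koszul (fun j => x j ^+ a j) g.
Proof.
have [[s [sd sm sreg]] _] := depth_d => pd.
by apply: (@koszul_exact _ _ _ s); rewrite ?sd// => b /sm; apply: sop_exp.
Qed.

(** Induction on the complement of [L]. If only j is missing, this is [koszul_nzd]. Otherwise a
    further variable x_l is adjoined with arbitrarily high exponent, and Krull's intersection
    theorem removes it. *)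
Lemma sop_exp_nzd (a : 'I_d -> nat) (L : {set 'I_d}) j r : j \notin L ->
  (forall l, 0 < a l)%N ->
  x j ^+ a j * r \in gen (mem L) (fun l => x l ^+ a l) ->
  r \in gen (mem L) (fun l => x l ^+ a l).
Proof.
have [k] := ubnP #|~: L|; elim: k L a => // k IH L a Lk jL a0 xr.
have gP b (T : {set 'I_d}) l : l \in T ->
    x l ^+ b l \in gen (mem T) (fun l => x l ^+ b l).
  by move=> lT; exact: (mem_gen (j := l)).
have [/existsP[l /andP[lL lj]]|] := boolP [exists l, (l \notin L) && (l != j)].
  apply: (krull_principal nR lm (sop_mem l)) => n.
  (* The exponents must be positive, hence n.+1; x_l^(n+1) still lies in (x_l^n). *)
  pose b i := if i == l then n.+1 else a i.
  have bE i : i \in L -> b i = a i.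
    by rewrite /b; case: eqP => // ->; rewrite (negPf lL).
  have : r \in gen (mem (l |: L)) (fun l => x l ^+ b l).
    apply: IH; rewrite ?in_setU1 ?negb_or ?jL ?andbT.
    - move: Lk; rewrite setCU (cardsD1 l (~: L)) inE lL add1n ltnS; apply: leq_ltn_trans.
      by apply: subset_leq_card; apply/subsetP => i; rewrite !inE.
    - by rewrite eq_sym.
    - by move=> i; rewrite /b; case: ifP.
    rewrite {1}/b eq_sym (negPf lj); apply: gen_sub xr => i; rewrite -[mem L i]/(i \in L) => iL.
    by rewrite -bE//; apply: gP; rewrite in_setU1 iL orbT.
  apply: gen_sub => i /=; rewrite in_setU1 => /orP[/eqP->|iL].
    apply/add_principalP; exists (x l); rewrite /b eqxx exprS subrr; exact: ideal0.
  apply/add_principalP; exists 0; rewrite mul0r subr0 bE//; exact: gP.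
rewrite negb_exists => /forallP Lj.
have LE i : (i \in L) = (i != j).
  have := Lj i; case: eqP => [->|_]; first by rewrite (negPf jL).
  by rewrite andbT negbK => ->.
have [[s [sd sm sreg]] _] := depth_d.
have sub : {subset gen (fun l => l != j) (fun l => x l ^+ a l)
             <= gen (mem L) (fun l => x l ^+ a l)}.
  by apply: gen_sub => l lj; apply: gP; rewrite LE.
apply: sub; apply: (@koszul_nzd _ _ (fun l => x l ^+ a l) s); rewrite ?sd//.
  by move=> b /sm; apply: sop_exp.
apply: gen_sub xr => l /=; rewrite LE => lj.
exact: (mem_gen (j := l)).
Qed.

Lemma sop_exp_perm_regular (a : 'I_d -> nat) :
  (forall l, 0 < a l)%N -> perm_regular (fun l => x l ^+ a l).
Proof. by move=> a0 L j r jL; apply: sop_exp_nzd. Qed.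

(** Hochster's monomial property. Removing l from [T] lowers its exponent in the ideal to 1: the
    factor x_l^(n+1) is cancelled modulo the powers of the other variables. At the empty set it
    remains that 1 is not in (x). *)
Lemma sop_monomial n : \prod_j x j ^+ n.+1 \notin
  gen (fun=> true) (fun j => x j ^+ n.+2).
Proof.
pose b (T : {set 'I_d}) j := if j \in T then n.+2 else 1%N.
suff key (T : {set 'I_d}) : \prod_(j in T) x j ^+ n.+1 \notin
    gen (fun=> true) (fun j => x j ^+ b T j).
  have := key [set: 'I_d]; rewrite (eq_bigl (fun=> true)) => [|j]; last by rewrite inE.
  apply: contra; apply: gen_sub => j _.
  by apply: (mem_gen (j := j)); rewrite /b ?inE.
have [k] := ubnP #|T|; elim: k T => // k IH T Tk.
have gP U j : x j ^+ b U j \in gen (fun=> true) (fun j => x j ^+ b U j).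
  exact: (mem_gen (j := j)).
case: (set_0Vmem T) => [->|[l lT]].
  rewrite big_set0; apply: contra sop_unit; apply: gen_sub => j _.
  by rewrite /b in_set0 expr1; exact: (mem_gen (j := j)).
apply/negP => /genP[c cE].
have Tlk : (#|T :\ l| < k)%N by move: Tk; rewrite (cardsD1 l) lT.
have /negP := IH _ Tlk; apply.
pose P := \prod_(j in T :\ l) x j ^+ n.+1.
pose a j := if j == l then n.+1 else b T j.
have aP : P - c l * x l \in gen (mem [set~ l]) (fun j => x j ^+ a j).
  apply: (@sop_exp_nzd a _ l); rewrite ?in_setC1 ?eqxx//.
    by move=> j; rewrite /a /b; case: ifP => // _; case: ifP.
  have -> : x l ^+ a l * (P - c l * x l) =
      \prod_(j in T) x j ^+ n.+1 - c l * x l ^+ n.+2.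
    rewrite (big_setD1 l)//= -/P /a eqxx [x l ^+ n.+2]exprS; ring.
  rewrite cE (bigD1 l)//= {1}/b lT addrAC subrr add0r; apply: ideal_sum => j jl.
  apply: ideal_mull; rewrite (_ : b T j = a j); last by rewrite /a (negPf jl).
  by apply: (mem_gen (j := j)); rewrite //= !inE.
rewrite -[X in X \in _](subrK (c l * x l)); apply: idealD; last first.
  by apply: ideal_mull; have := gP (T :\ l) l; rewrite {1}/b in_setD1 eqxx expr1.
apply: gen_sub aP => j /=; rewrite in_setC1 => jl.
by have := gP (T :\ l) j; rewrite {1}/b in_setD1 jl/= /a (negPf jl).
Qed.

End SystemOfParameters.

(** * Monomial ideals in a permutable regular sequence *)

Section Monomials.
Context {R : comNzRingType} {d : nat} (u : 'I_d -> R).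
Implicit Types (H G : {set 'I_d}) (HH : {set {set 'I_d}}).

Definition smon H : R := \prod_(j in H) u j.

Lemma smon0 : smon set0 = 1. Proof. exact: big_set0. Qed.

Lemma smonD H G : G \subset H -> smon H = smon G * smon (H :\: G).
Proof.
move=> GH; rewrite /smon (big_setID G)/=; congr (_ * _).
by rewrite (setIidPr GH).
Qed.

Lemma smonU H G : smon (H :|: G) = smon H * smon (G :\: H).
Proof. by rewrite (smonD (subsetUl H G)) setDUl setDv set0U. Qed.

Lemma mem_gen_smon (P : pred {set 'I_d}) H G (r : R) : P G -> G \subset H ->
  smon H * r \in gen P smon.
Proof.
move=> PG GH; rewrite (smonD GH) -mulrA; apply: ideal_mulr.
exact: (mem_gen (j := G)).
Qed.

Definition unsettled HH := [set l | [exists H in HH, (l \in H) && (1 < #|H|)%N]].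

Hypothesis u_reg : perm_regular u.

(** Once the generators containing l are divided by u_l and subtracted, only those without l remain.
    Regularity of u_l modulo the latter is a hypothesis because [nzd_smon] uses this lemma inside
    its induction, where regularity is known for smaller families only. *)
Lemma colon_var (l : 'I_d) HH (r : R) :
  (forall r, u l * r \in gen (mem [set H in HH | l \notin H]) smon ->
     r \in gen (mem [set H in HH | l \notin H]) smon) ->
  u l * r \in gen (mem HH) smon ->
  r \in gen (mem [set H :\ l | H in HH]) smon.
Proof.
move=> nzd /genP[f fE].
pose q := \sum_(H in HH | l \in H) f H * smon (H :\ l).
have qE : q \in gen (mem [set H :\ l | H in HH]) smon.
  apply: ideal_sum => H /andP[HHH lH]; apply: ideal_mull.
  by apply: (mem_gen (j := H :\ l)) => //=; apply: imset_f.
rewrite -(subrK q r); apply: idealD => //.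
have : r - q \in gen (mem [set H in HH | l \notin H]) smon.
  apply: nzd; rewrite mulrBr fE (bigID (fun H => l \in H))/=.
  rewrite [X in X + _ - _](_ : _ = u l * q); last first.
    rewrite mulr_sumr; apply: eq_bigr => H /andP[_ lH].
    by rewrite /smon (big_setD1 l)//= mulrCA.
  rewrite addrAC subrr add0r; apply: ideal_sum => H /andP[HHH lH].
  by apply: ideal_mull; apply: (mem_gen (j := H)) => //=; rewrite inE HHH.
apply: gen_sub => H /=; rewrite inE => /andP[HHH lH].
apply: (mem_gen (j := H)) => //=; apply/imsetP; exists H => //.
by apply/setP => i; rewrite !inE; case: eqP => // ->; rewrite (negPf lH).
Qed.

Lemma unsettled_lt HH HH' l : l \in unsettled HH -> unsettled HH' \subset unsettled HH ->
  l \notin unsettled HH' -> (#|unsettled HH'| < #|unsettled HH|)%N.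
Proof.
by move=> lHH sub lHH'; apply/proper_card/properP; split=> //; exists l.
Qed.

(* Induction on the variables occurring in generators of degree at least 2:
   if [l] is one of them, pass to [J + (u l)] and to [J : u l]. *)
Lemma nzd_smon (j : 'I_d) HH (r : R) : (forall H, H \in HH -> j \notin H) ->
  u j * r \in gen (mem HH) smon -> r \in gen (mem HH) smon.
Proof.
have [k] := ubnP #|unsettled HH|; elim: k HH j r => // k IH HH j r HHk jHH jr.
have [U0|[l lU]] := set_0Vmem (unsettled HH).
  have [H0|H0] := boolP (set0 \in HH).
    by rewrite -[r]mulr1 -smon0; apply: ideal_mull; apply: (mem_gen (j := set0)).
  pose L := [set l | [set l] \in HH].
  have HHL H : H \in HH -> exists2 l, l \in L & H = [set l].
    move=> HHH; have [Hn|[l lH]] := set_0Vmem H; first by rewrite -Hn HHH in H0.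
    have H1 : #|H| == 1%N.
      rewrite eqn_leq andbC (cardsD1 l) lH/= add1n ltnNge; apply/negP => H1.
      have : l \in unsettled HH.
        by rewrite inE; apply/existsP; exists H; rewrite HHH lH (cardsD1 l) lH.
      by rewrite U0 inE.
    have /cards1P[l' Hl'] := H1; exists l' => //.
    by rewrite inE -Hl'.
  have sub1 : {subset gen (mem HH) smon <= gen (mem L) u}.
    apply: gen_sub => _ /HHL[l lL ->]; rewrite /smon big_set1.
    exact: (mem_gen (j := l)).
  have sub2 : {subset gen (mem L) u <= gen (mem HH) smon}.
    apply: gen_sub => l; rewrite /= inE => lHH; apply: (mem_gen (j := [set l])) => //.
    by rewrite /smon big_set1.
  apply/sub2/u_reg/sub1/jr; rewrite inE; apply/negP => /jHH.
  by rewrite inE eqxx.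
pose HH0 := [set H in HH | l \notin H].
pose HH1 := [set l] |: HH0.
have jl : j != l.
  move: lU; rewrite inE => /existsP[H /and3P[/jHH jH lH _]].
  by apply: contraNneq jH => ->.
have HH0k : (#|unsettled HH0| < k)%N.
  rewrite -ltnS; apply: leq_trans HHk; rewrite ltnS; apply: (unsettled_lt lU).
    apply/subsetP => i; rewrite !inE => /existsP[H /and3P[]]; rewrite inE => /andP[? _] *.
    by apply/existsP; exists H; apply/and3P.
  rewrite inE; apply/existsP => -[H /and3P[]]; rewrite inE => /andP[_ /negPf->].
  by [].
have HH1k : (#|unsettled HH1| < k)%N.
  rewrite -ltnS; apply: leq_trans HHk; rewrite ltnS; apply: (unsettled_lt lU).
    apply/subsetP => i; rewrite !inE => /existsP[H /and3P[]].
    rewrite !inE => /orP[/eqP->|]; first by rewrite cards1.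
    by move=> /andP[? _] *; apply/existsP; exists H; apply/and3P.
  rewrite inE; apply/existsP => -[H /and3P[]]; rewrite !inE => /orP[/eqP->|].
    by rewrite cards1.
  by move=> /andP[_ /negPf->].
have HH2k : (#|unsettled [set H :\ l | H in HH]| < k)%N.
  rewrite -ltnS; apply: leq_trans HHk; rewrite ltnS; apply: (unsettled_lt lU).
    apply/subsetP => i; rewrite !inE => /existsP[_ /and3P[/imsetP[H HHH ->]]].
    rewrite inE => /andP[_ iH] H1; apply/existsP; exists H; apply/and3P; split=> //.
    by apply: leq_trans H1 _; apply/subset_leq_card/subsetDl.
  rewrite inE; apply/existsP => -[_ /and3P[/imsetP[H HHH ->]]].
  by rewrite !inE eqxx.
have r1 : r \in gen (mem HH1) smon.
  apply: (IH HH1 j) => //.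
    by move=> H; rewrite !inE => /orP[/eqP->|/andP[/jHH//]]; rewrite inE.
  apply: gen_sub jr => H /= HHH; case: (boolP (l \in H)) => lH.
    rewrite -[smon H]mulr1; apply: (mem_gen_smon (G := [set l])); last by rewrite sub1set.
    by rewrite /= !inE eqxx.
  by apply: (mem_gen (j := H)) => //=; rewrite !inE HHH lH orbT.
have colonl t : u l * t \in gen (mem HH) smon ->
    t \in gen (mem [set H :\ l | H in HH]) smon.
  apply: colon_var => {}t; apply: (IH HH0 l) => // H.
  by rewrite inE => /andP[].
have [a ra] : exists a, r - u l * a \in gen (mem HH0) smon.
  move/genP: r1 => [f fE]; exists (f [set l]); rewrite fE.
  rewrite (bigD1 [set l])/=; last by rewrite !inE eqxx.
  rewrite {1}/smon big_set1 [u l * _]mulrC addrAC subrr add0r.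
  apply: ideal_sum => H; rewrite in_setU1 => /andP[/orP[->//|HHH] _].
  by apply: ideal_mull; apply: (mem_gen (j := H)).
have sub0 : {subset gen (mem HH0) smon <= gen (mem HH) smon}.
  apply: gen_sub => H /=; rewrite inE => /andP[HHH _].
  exact: (mem_gen (j := H)).
rewrite -(subrK (u l * a) r); apply: idealD; first exact: sub0.
(* Now r = u_l a modulo generators without l, and u_j u_l a lies in the ideal; so u_j a lies in the
   colon by u_l, and the induction hypothesis for that colon cancels u_j. *)
have : a \in gen (mem [set H :\ l | H in HH]) smon.
  apply: (IH _ j) => //.
    by move=> _ /imsetP[H /jHH jH ->]; rewrite inE (negPf jH) andbF.
  apply: colonl; rewrite mulrCA -[u l * a](subKr r) mulrBr; apply: idealB => //.
  by apply: ideal_mull; apply: sub0.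
move=> /genP[f ->]; rewrite mulr_sumr; apply: ideal_sum => _ /imsetP[H HHH ->].
rewrite mulrCA; apply: ideal_mull; case: (boolP (l \in H)) => lH.
  by apply: (mem_gen (j := H)) => //; rewrite [RHS](big_setD1 l).
apply: ideal_mull; apply: (mem_gen (j := H)) => //; congr smon.
by apply/setP => i; rewrite !inE; case: eqP => // ->; rewrite (negPf lH).
Qed.

Lemma colon_smon G HH (r : R) : smon G * r \in gen (mem HH) smon ->
  r \in gen (mem [set H :\: G | H in HH]) smon.
Proof.
have [k] := ubnP #|G|; elim: k G HH r => // k IH G HH r Gk.
have [->|[l lG]] := set_0Vmem G.
  rewrite smon0 mul1r; apply: gen_sub => H HHH; apply: (mem_gen (j := H :\: set0)).
    exact: imset_f.
  by rewrite setD0.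
rewrite {1}/smon (big_setD1 l)//= -mulrA => /colon_var lr.
have : smon (G :\ l) * r \in gen (mem [set H :\ l | H in HH]) smon.
  apply: lr => {}r; apply: nzd_smon => H; rewrite inE => /andP[]//.
move=> /IH; rewrite (cardsD1 l G) lG add1n ltnS in Gk; move=> /(_ Gk).
apply: gen_sub => _ /imsetP[_ /imsetP[H HHH ->] ->].
apply: (mem_gen (j := H :\: G)); first exact: imset_f.
congr smon; apply/setP => i; rewrite !inE.
by case: eqP => [->|]; rewrite ?lG.
Qed.

Lemma smon_lreg H (r : R) : smon H * r = 0 -> r = 0.
Proof.
move=> Hr; have := @colon_smon H set0 r; rewrite Hr => /(_ (ideal0 _)).
rewrite imset0 => /genP[f ->]; apply: big1 => G.
by rewrite /= inE.
Qed.

End Monomials.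

Section ActRing.
Context {R : comNzRingType}.

(* [act] on ring-valued functions, with multiplication in place of the scaling
   of [R^o]. *)
Definition ract (X Y : finType) (D : X -> Y -> R) (f : Y -> R) (t : X) : R :=
  \sum_y D t y * f y.

Lemma ract_act (X Y : finType) (D : X -> Y -> R) (f : Y -> R) :
  ract D f = @act R X Y R^o D f.
Proof. by []. Qed.

Lemma ractZD (X Y : finType) (D : X -> Y -> R) (a : R) f g t :
  ract D (fun y => a * f y + g y) t = a * ract D f t + ract D g t.
Proof.
by rewrite /ract mulr_sumr -big_split; apply: eq_bigr => y _ /=; ring.
Qed.

Lemma ractZ (X Y : finType) (D : X -> Y -> R) (a : R) f t :
  ract D (fun y => a * f y) t = a * ract D f t.
Proof. by rewrite /ract mulr_sumr; apply: eq_bigr => y _ /=; ring. Qed.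

Lemma ractB (X Y : finType) (D : X -> Y -> R) f g t :
  ract D (fun y => f y - g y) t = ract D f t - ract D g t.
Proof. by rewrite /ract -sumrB; apply: eq_bigr => y _ /=; ring. Qed.

Lemma ract_ideal (X Y : finType) (D : X -> Y -> R) (J : ideal R) f t :
  (forall y, f y \in J) -> ract D f t \in J.
Proof. by move=> fJ; apply: ideal_sum => y _; apply: ideal_mull. Qed.

End ActRing.

(** * Exactness, one monomial at a time *)

Section MonomialFiltration.
Context {R : comNzRingType} {d : nat} (u : 'I_d -> R).
Hypothesis u_reg : perm_regular u.
Context {X : finType} (L : X -> {set 'I_d}) (D : X -> X -> R) (Y : pred X).
Hypothesis D_comp : forall f s, ract D (ract D f) s = 0.

(* A contraction, on [Y], of the subcomplex of the generators whose monomial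
   divides [smon u H]. *)
Definition contraction_at (H : {set 'I_d}) :=
  exists P Q : X -> X -> R,
    [/\ forall s t, ~~ (L s \subset H) -> P s t = 0,
        forall s t, ~~ (Y s && (L s \subset H)) -> Q s t = 0 &
        forall p : X -> R, (forall s, ~~ (Y s && (L s \subset H)) -> p s = 0) ->
          forall s, p s = ract D (ract P p) s + ract Q (ract D p) s].

(** Induction on the up-closed set [U], removing a minimal H. The coefficient r of smon u H is a
    cocycle modulo the colon of the other monomials by smon u H. The contraction splits r into a
    coboundary and Q (D r); multiplied by smon u H, the latter involves only the monomials of unions
    of H with other members of [U], again in [U]. *)
Lemma monomial_filtration (U : {set {set 'I_d}}) (c : X -> R) :
  (forall H H' : {set 'I_d}, H \in U -> H \subset H' -> H' \in U) ->
  (forall H, H \in U -> contraction_at H) ->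
  (forall s, c s \in gen (fun H => (H \in U) && (L s \subset H)) (smon u)) ->
  (forall s, ~~ Y s -> c s = 0) ->
  (forall s, ract D c s = 0) ->
  exists b : X -> R, forall s, c s = ract D (fun t => smon u (L t) * b t) s.
Proof.
have [k] := ubnP #|U|; elim: k U c => // k IH U c Uk Uup Uc cU cY Dc.
have [U0|[H0 H0U]] := set_0Vmem U.
  exists (fun=> 0) => s; have /genP[f ->] := cU s.
  rewrite big_pred0 => [|H]; last by rewrite U0 inE.
  by rewrite /ract big1// => t _; rewrite !mulr0.
case: (arg_minnP (fun H : {set 'I_d} => #|H|) H0U) => H HU Hmin.
have {}HU : H \in U by [].
pose U' := U :\ H.
have U'k : (#|U'| < k)%N by move: Uk; rewrite (cardsD1 H) HU.
have U'sub G : G \in U' -> ~~ (G \subset H).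
  rewrite !inE => /andP[GH GU]; apply: contra GH => sGH.
  by rewrite eqEcard sGH Hmin.
have [P [Q [PH QH PQ]]] := Uc H HU.
have /choice[f fE] s : exists f, c s = \sum_(H | (H \in U) && (L s \subset H)) f H * smon u H.
  exact/genP/cU.
pose r s := if Y s && (L s \subset H) then f s H else 0.
have cr s : c s - smon u H * r s \in gen (fun G => (G \in U') && (L s \subset G)) (smon u).
  rewrite /r; case: (boolP (Y s)) => Ys; last by rewrite cY//= mulr0 subr0 ideal0.
  rewrite fE/=; case: ifP => LsH.
    rewrite (bigD1 H) ?HU//= mulrC addrAC subrr add0r; apply: ideal_sum => G.
    move=> /andP[/andP[GU LG] GH]; apply: ideal_mull; apply: (mem_gen (j := G)) => //.
    by rewrite LG !inE GU GH.
  rewrite mulr0 subr0; apply: ideal_sum => G /andP[GU LG].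
  have GH : G != H by apply: contraFneq LsH => <-.
  apply: ideal_mull; apply: (mem_gen (j := G)) => //.
  by rewrite LG !inE GU GH.
have Dr s : ract D r s \in gen (mem [set G :\: H | G in U']) (smon u).
  apply: colon_smon => //; rewrite -ractZ.
  rewrite (_ : ract D _ s = - ract D (fun t => c t - smon u H * r t) s).
    apply/idealN/ract_ideal => t; apply: gen_sub (cr t) => G /andP[GU' _].
    exact: (mem_gen (j := G)).
  by rewrite ractB Dc sub0r opprK.
pose c' s := c s - smon u H * ract D (ract P r) s.
have c'E s : c' s = (c s - smon u H * r s) + smon u H * ract Q (ract D r) s.
  have rY t : ~~ (Y t && (L t \subset H)) -> r t = 0 by rewrite /r => /negPf->.
  have PQr := PQ r rY s; rewrite /c' PQr.
  by move: (ract D (ract P r) s) (ract Q _ s) => p q; ring.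
have [|||||b bE] := IH U' c' U'k.
- move=> G G' GU' GG'; have := U'sub _ GU'; move: GU'; rewrite !inE => /andP[GH GU] nGH.
  rewrite (Uup G G')// andbT; apply: contraNneq nGH => <-//.
- by move=> G; rewrite inE => /andP[_ /Uc].
- move=> s; rewrite c'E; apply: idealD => //.
  case: (boolP (Y s && (L s \subset H))) => [/andP[_ LsH]|nYL]; last first.
    by rewrite /ract big1 ?mulr0 ?ideal0// => t _; rewrite QH ?mul0r.
  have : ract Q (ract D r) s \in gen (mem [set G :\: H | G in U']) (smon u).
    exact: ract_ideal.
  move=> /genP[g ->]; rewrite mulr_sumr; apply: ideal_sum => _ /imsetP[G GU' ->].
  rewrite mulrCA; apply: ideal_mull; rewrite -smonU.
  apply: (mem_gen (j := H :|: G)) => //; rewrite (subset_trans LsH) ?subsetUl// andbT.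
  move: (GU'); rewrite !inE => /andP[_ GU]; rewrite (Uup G) ?subsetUr// andbT.
  by apply: contraNneq (U'sub _ GU') => <-; rewrite subsetUr.
- move=> s nYs; rewrite c'E cY// /r (negPf nYs)/= mulr0 subr0 add0r.
  by rewrite /ract big1 ?mulr0// => t _; rewrite QH ?mul0r ?(negPf nYs).
- by move=> s; rewrite ractB ractZ Dc D_comp mulr0 subr0.
(* The first factor completes smon u (L t) to smon u H wherever P r may be nonzero, that is for L t
   inside H. *)
exists (fun t => smon u (H :\: L t) * ract P r t + b t) => s.
rewrite [LHS](_ : _ = smon u H * ract D (ract P r) s + c' s); last by rewrite /c'; ring.
rewrite bE -ractZ -[RHS]mul1r -[LHS]mul1r; congr (1 * _).
rewrite /ract -big_split/=; apply: eq_bigr => t _.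
rewrite -mulrDr; congr (_ * _); rewrite mulrDr; congr (_ + _).
case: (boolP (L t \subset H)) => LtH; first by rewrite mulrA -smonD.
by rewrite big1 ?mulr0// => y _; rewrite PH ?mul0r.
Qed.

End MonomialFiltration.

(** * The Taylor complex *)

Section Taylor.
Context {R : comNzRingType} {d s : nat}.
Implicit Types (u w : 'I_d -> R) (A : 'I_s -> {set 'I_d}).
Implicit Types (sg tau rho : {set 'I_s}) (M : lmodType R).

Definition cup A sg := \bigcup_(a in sg) A a.

Lemma cup0 A : cup A set0 = set0. Proof. exact: big_set0. Qed.

Lemma cup_set1 A a : cup A [set a] = A a. Proof. exact: big_set1. Qed.

Lemma cup_subset A sg tau : tau \subset sg -> cup A tau \subset cup A sg.
Proof.
move=> ts; apply/bigcupsP => a at_; apply: bigcup_sup.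
exact: (subsetP ts).
Qed.

(* The rows of [taylor u A] are the boundaries in the Taylor complex of the
   monomials [smon u (A a)]. *)
Definition taylor u A sg tau : R :=
  incid sg tau * smon u (cup A sg :\: cup A tau).

Lemma incid_nz sg tau : (incid sg tau : R) != 0 -> tau \subset sg /\ #|sg| = #|tau|.+1.
Proof. by move=> /incid_sub/andP[? /eqP]. Qed.

Lemma taylor_nz u A sg tau : taylor u A sg tau != 0 ->
  tau \subset sg /\ #|sg| = #|tau|.+1.
Proof.
move=> T0; apply: incid_nz; apply: contraNneq T0 => I0.
by rewrite /taylor I0 mul0r.
Qed.

Lemma taylor_comp u A sg rho :
  \sum_tau taylor u A sg tau * taylor u A tau rho = 0.
Proof.
transitivity ((\sum_tau incid sg tau * incid tau rho) * smon u (cup A sg :\: cup A rho)).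
  2: by rewrite incid_comp mul0r.
rewrite mulr_suml.
apply: eq_bigr => tau _; rewrite /taylor.
have [->|/incid_nz[ts _]] := eqVneq (incid sg tau : R) 0; first by rewrite !mul0r.
have [->|/incid_nz[rt _]] := eqVneq (incid tau rho : R) 0.
  by rewrite !(mul0r, mulr0).
rewrite (@smonD _ _ _ (cup A sg :\: cup A rho) (cup A tau :\: cup A rho)); last first.
  by apply: setSD; apply: cup_subset.
rewrite (_ : _ :\: _ :\: _ = cup A sg :\: cup A tau); first by ring.
apply/setP => i; rewrite !inE; have /subsetP/(_ i) := cup_subset A rt.
by case: (i \in cup A rho); case: (i \in cup A tau) => // /(_ isT).
Qed.

Lemma act_comp (X Y Z : finType) M (D : X -> Y -> R) (D' : Y -> Z -> R) (f : Z -> M) t :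
  act D (act D' f) t = \sum_z (\sum_y D t y * D' y z) *: f z.
Proof.
rewrite /act; under eq_bigr do rewrite scaler_sumr.
rewrite exchange_big; apply: eq_bigr => z _; rewrite scaler_suml.
by apply: eq_bigr => y _; rewrite scalerA.
Qed.

Lemma act_taylor_comp u A M (f : {set 'I_s} -> M) sg :
  act (taylor u A) (act (taylor u A) f) sg = 0.
Proof.
by rewrite act_comp big1// => t _; rewrite taylor_comp scale0r.
Qed.

Lemma act_taylorT_comp u A M (f : {set 'I_s} -> M) sg :
  act (transp (taylor u A)) (act (transp (taylor u A)) f) sg = 0.
Proof.
rewrite act_comp big1// => t _; rewrite /transp.
under eq_bigr do rewrite mulrC.
by rewrite taylor_comp scale0r.
Qed.

Lemma act_taylorE u A M (f : {set 'I_s} -> M) sg :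
  act (taylor u A) f sg =
  \sum_(a in sg) (sgn sg a * smon u (cup A sg :\: cup A (sg :\ a))) *: f (sg :\ a).
Proof.
pose g tau := smon u (cup A sg :\: cup A tau) *: f tau.
transitivity (act incid g sg).
  by apply: eq_bigr => t _; rewrite /taylor scalerA.
rewrite act_incid [RHS]big_mkcond; apply: eq_bigr => a _.
by rewrite /ext_op /g scalerA.
Qed.

Lemma smonM u w H : smon (fun j => u j * w j) H = smon u H * smon w H.
Proof. exact: big_split. Qed.

(** These scalings are the transition maps, from u to u w, of the direct system of dual Taylor
    complexes. *)
Lemma act_taylorM u w A M (f : {set 'I_s} -> M) sg :
  act (taylor (fun j => u j * w j) A) (fun tau => smon w (cup A tau) *: f tau) sg =
  smon w (cup A sg) *: act (taylor u A) f sg.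
Proof.
rewrite scaler_sumr; apply: eq_bigr => tau _; rewrite /taylor !scalerA smonM.
have [->|/incid_nz[ts _]] := eqVneq (incid sg tau : R) 0; first by rewrite !(mul0r,mulr0).
by rewrite (smonD w (cup_subset A ts)); congr (_ *: _); ring.
Qed.

(* Rescaling embeds the Taylor complex into the chain complex of the full
   simplex. *)
Lemma ract_incidT u A (f : {set 'I_s} -> R) tau :
  ract (transp incid) (fun sg => smon u (cup A sg) * f sg) tau =
  smon u (cup A tau) * ract (transp (taylor u A)) f tau.
Proof.
rewrite mulr_sumr; apply: eq_bigr => sg _; rewrite /taylor /transp.
have [->|/incid_nz[ts _]] := eqVneq (incid sg tau : R) 0; first by rewrite !(mul0r,mulr0).
by rewrite (smonD u (cup_subset A ts)); ring.
Qed.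

(** The cochain counterpart of [ract_incidT]. Unions grow along the coboundary, so it is the
    complementary monomial that rescales. *)
Lemma ract_incid u A (f : {set 'I_s} -> R) sg :
  ract incid (fun tau => smon u (~: cup A tau) * f tau) sg =
  smon u (~: cup A sg) * ract (taylor u A) f sg.
Proof.
rewrite mulr_sumr; apply: eq_bigr => tau _; rewrite /taylor.
have [->|/incid_nz[ts _]] := eqVneq (incid sg tau : R) 0; first by rewrite !(mul0r,mulr0).
have sub : ~: cup A sg \subset ~: cup A tau by rewrite setCS cup_subset.
rewrite (smonD u sub) (_ : ~: _ :\: ~: _ = cup A sg :\: cup A tau); first by ring.
by apply/setP => i; rewrite !inE negbK andbC.
Qed.

Lemma ract_incidT_comp (g : {set 'I_s} -> R) sg :
  ract (transp incid) (ract (transp incid) g) sg = 0.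
Proof.
rewrite !ract_act act_comp big1// => rho _.
rewrite (_ : \sum_y _ = 0) ?scale0r//.
by under eq_bigr do rewrite mulrC; exact: incid_comp.
Qed.

Lemma ract_incid_comp (g : {set 'I_s} -> R) sg :
  ract incid (ract incid g) sg = 0.
Proof. by rewrite !ract_act act_comp big1// => rho _; rewrite incid_comp scale0r. Qed.

(** The sets with union inside H form the full simplex on the a with A a inside H, a cone over any
    such a. Without such an a only the empty set is left, and it is excluded. *)
Lemma cup_contraction A H :
  contraction_at (cup A) (transp (@incid R s)) (fun sg => sg != set0) H.
Proof.
case: (boolP [exists a, A a \subset H]) => [/existsP[a aH]|nH].
  pose P sg tau : R :=
    if cup A sg \subset H then (a \in sg)%:R * sgn sg a * (tau == sg :\ a)%:R else 0.
  have PE (p : {set 'I_s} -> R) sg : (forall tau, ~~ (cup A tau \subset H) -> p tau = 0) ->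
      ract P p sg = @ext_op R s a R^o p sg.
    move=> p0; rewrite /ract /ext_op (bigD1 (sg :\ a))//= big1 => [|t ta].
      rewrite addr0 /P eqxx mulr1; case: (boolP (a \in sg)) => asg; last first.
        by case: ifP; rewrite !mul0r.
      case: ifP => sgH; first by rewrite mul1r.
      rewrite mul0r p0 ?scaler0//; apply/negP => sub; move/negP: sgH; apply.
      rewrite -(setD1K asg); apply/bigcupsP => b; rewrite in_setU1 => /orP[/eqP->//|bs].
      by apply: subset_trans sub; apply: bigcup_sup.
    by rewrite /P (negPf ta) mulr0 if_same mul0r.
  exists P, P; split=> [sg tau nH|sg tau|p p0 sg].
  - by rewrite /P (negPf nH).
  - rewrite /P negb_and negbK => /orP[/eqP->|/negPf->//].
    by rewrite inE !mul0r if_same.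
  have pL tau : ~~ (cup A tau \subset H) -> p tau = 0.
    by move=> nt; apply: p0; rewrite (negPf nt) andbF.
  rewrite [ract P (ract _ _) _]PE; last first.
    move=> tau nt; rewrite /ract big1// => t _; rewrite /transp.
    have [->|/incid_nz[ts _]] := eqVneq (incid t tau : R) 0; first by rewrite mul0r.
    rewrite pL ?mulr0//; apply: contra nt; apply: subset_trans.
    exact: cup_subset.
  have -> : ract (transp incid) (ract P p) sg =
            ract (transp incid) (@ext_op R s a R^o p) sg.
    by apply: eq_bigr => t _; rewrite PE.
  exact: (esym (@incid_contraction R s a R^o p sg)).
have nP sg : ~~ ((sg != set0) && (cup A sg \subset H)).
  apply: contra nH => /andP[/set0Pn[a asg] sgH]; apply/existsP; exists a.
  by apply: subset_trans sgH; apply: bigcup_sup.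
exists (fun _ _ => 0), (fun _ _ => 0); split=> // p p0 sg.
rewrite p0// {1}/ract big1 => [|t _]; last first.
  by rewrite /ract big1 ?mulr0// => ? _; rewrite mul0r.
by rewrite /ract big1 ?addr0// => t _; rewrite mul0r.
Qed.

(** Taylor's resolution. The condition at [set0] discards degree 0, whose homology is R modulo the
    monomials. *)
Lemma taylor_exact u A (f : {set 'I_s} -> R) : perm_regular u ->
  (forall tau, ract (transp (taylor u A)) f tau = 0) -> f set0 = 0 ->
  exists g : {set 'I_s} -> R, forall sg, f sg = ract (transp (taylor u A)) g sg.
Proof.
move=> u_reg f0 fs0.
have [||||b bE] := monomial_filtration u_reg ract_incidT_comp (U := [set: {set 'I_d}])
   (c := fun sg => smon u (cup A sg) * f sg) _ (fun H _ => cup_contraction A H).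
- by move=> H H'; rewrite !inE.
- move=> sg; rewrite mulrC; apply: ideal_mull.
  by apply: (mem_gen (j := cup A sg)) => //; rewrite inE subxx.
- by move=> sg; rewrite negbK => /eqP->; rewrite fs0 mulr0.
- by move=> sg; rewrite ract_incidT f0 mulr0.
exists b => sg; apply/eqP; rewrite -subr_eq0; apply/eqP.
by apply: (smon_lreg u_reg (H := cup A sg)); rewrite mulrBr bE ract_incidT subrr.
Qed.

End Taylor.

Lemma cup_id (d : nat) (F : {set 'I_d}) : cup (fun a => [set a]) F = F.
Proof.
apply/setP => i; apply/bigcupP/idP => [[a aF]|iF]; first by rewrite inE => /eqP->.
by exists i; rewrite ?inE.
Qed.

(** Thus one comparison with injective resolutions serves both for the support in I and, with the
    variables as monomials, for the support in m. *)
Lemma ract_koszul (R : comNzRingType) (d : nat) (u : 'I_d -> R) (f : {set 'I_d} -> R) F :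
  ract (taylor u (fun a => [set a])) f F = koszul u f F.
Proof.
rewrite ract_act act_taylorE koszulE; apply: eq_bigr => a aF; rewrite !cup_id.
rewrite (_ : F :\: (F :\ a) = [set a]).
  by rewrite /smon big_set1 mulrCA mulrA.
by apply/setP => i; rewrite !inE negb_and negbK andb_orl andNb orbF; case: eqP => // ->.
Qed.

(** * Comparison with injective resolutions *)

Section InjectiveExtension.
Context {R : comNzRingType}.

Definition linear_of (A B : lmodType R) (f : A -> B) (lf : linear f) : {linear A -> B} :=
  HB.pack_for {linear A -> B} f (GRing.isLinear.Build R A B *:%R f lf).

Lemma quotmod_pi0 (M : lmodType R) (N : submodClosed M) (v : M) :
  (quotmod_pi N v == 0) = (v \in N).
Proof.
apply/eqP/idP => [|vN]; rewrite -(raddf0 (quotmod_pi N)).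
  by move=> /quotmod_pi_eq; rewrite subr0.
by apply/quotmod_pi_eq; rewrite subr0.
Qed.

Lemma quotmod_lift (A B : lmodType R) (N : submodClosed A) (f : {linear A -> B}) :
  (forall v, v \in N -> f v = 0) ->
  exists f' : {linear quotmod N -> B}, forall v, f' (quotmod_pi N v) = f v.
Proof.
move=> Nf; pose F (u : quotmod N) : B := f (repr (u : Quotient.quot (quotmod_rel N))).
have FE v : F (quotmod_pi N v) = f v.
  apply/eqP; rewrite -subr_eq0 -raddfB; apply/eqP/Nf/quotmod_pi_eq.
  by rewrite /quotmod_pi reprK.
have lF : linear F.
  move=> a u v; have [u' ->] := quotmod_piP u; have [v' ->] := quotmod_piP v.
  by rewrite -linearP !FE linearP.
by exists (linear_of lF).
Qed.

Lemma injective_extend (E : lmodType R) (A B : lmodType R) (f : {linear A -> B})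
    (g : {linear A -> E}) : injective_module E ->
  (forall a, f a = 0 -> g a = 0) ->
  exists h : {linear B -> E}, forall a, h (f a) = g a.
Proof.
move=> injE fg.
have [f' f'E] := @quotmod_lift _ _ (kernel f) f (fun v => fun vf => eqP vf).
have [g' g'E] : exists g' : {linear quotmod (kernel f) -> E},
    forall v, g' (quotmod_pi (kernel f) v) = g v.
  by apply: quotmod_lift => v /eqP/fg.
have injf' : injective f'.
  move=> u v; have [u' ->] := quotmod_piP u; have [v' ->] := quotmod_piP v.
  rewrite !f'E => fuv; apply/quotmod_pi_eq.
  have : f (u' - v') = 0 by rewrite linearB fuv subrr.
  by move=> /eqP.
have [h hE] := injE _ _ _ g' injf'.
by exists h => a; rewrite -f'E hE g'E.
Qed.

Variables (X : finType) (D : X -> X -> R) (x0 : X).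

(** Hom(-, E) preserves exactness: w is a map from the free module on X that kills boundaries, hence
    all cycles (the coordinate at [x0] does not count); so it extends along the boundary map. Later
    [x0] is the empty set. *)
Lemma cochain_exact (E : lmodType R) (w : X -> E) : injective_module E ->
  (forall f : X -> R, (forall t, ract (transp D) f t = 0) -> f x0 = 0 ->
     exists g : X -> R, forall t, f t = ract (transp D) g t) ->
  (forall t, D x0 t = 0) ->
  (forall s, act D w s = 0) -> w x0 = 0 ->
  exists v : X -> E, forall s, w s = act D v s.
Proof.
move=> injE exD D0 Dw w0.
pose bd (f : {ffun X -> R^o}) : {ffun X -> R^o} := [ffun t => ract (transp D) f t].
have bdlin : linear bd.
  move=> a f g; apply/ffunP => t; rewrite !ffunE -ractZD; apply: eq_bigr => y _.
  by rewrite !ffunE.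
pose ev (f : {ffun X -> R^o}) : E := \sum_y (f y : R) *: w y.
have evlin : linear ev.
  move=> a f g; rewrite /ev scaler_sumr -big_split; apply: eq_bigr => y _.
  by rewrite !ffunE scalerDl scalerA.
have evbd (g : X -> R) : \sum_y ract (transp D) g y *: w y = 0.
  rewrite /ract; under eq_bigr do rewrite scaler_suml.
  rewrite exchange_big big1// => z _.
  rewrite (eq_bigr (fun y => g z *: (D z y *: w y))) => [|y _]; last first.
    by rewrite scalerA mulrC.
  by rewrite -scaler_sumr -[\sum_y _]/(act D w z) Dw scaler0.
have [|h hE] := injective_extend (f := linear_of bdlin) (g := linear_of evlin) injE.
  move=> f /= /ffunP f0.
  pose f' y : R := if y == x0 then 0 else f y.
  have [||g gE] := exD f'.
  - move=> t; have := f0 t; rewrite !ffunE => <-.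
    apply: eq_bigr => y _; rewrite /f' /transp; case: eqP => // ->.
    by rewrite D0 !mul0r.
  - by rewrite /f' eqxx.
  rewrite /ev -[RHS](evbd g); apply: eq_bigr => y _; rewrite -gE /f'.
  by case: eqP => // ->; rewrite w0 !scaler0.
pose dl t : {ffun X -> R^o} := [ffun y => (y == t)%:R].
exists (fun t => h (dl t)) => s.
have -> : w s = ev (dl s).
  rewrite /ev (bigD1 s)//= big1 => [|y ys]; first by rewrite ffunE eqxx scale1r addr0.
  by rewrite ffunE (negPf ys) scale0r.
rewrite -[ev _]hE /act -[RHS](_ : h (\sum_t D s t *: dl t) = _); last first.
  by rewrite linear_sum; apply: eq_bigr => t _; rewrite linearZ.
congr (h _); apply/ffunP => t; rewrite sum_ffunE ffunE /ract (bigD1 s)//= big1.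
  rewrite /transp ffunE eqxx mulr1 addr0 (bigD1 t)//= big1 => [|y yt].
    by rewrite !ffunE eqxx addr0 [_ *: _]mulr1.
  by rewrite !ffunE eq_sym (negPf yt) [_ *: _]mulr0.
by move=> y ys; rewrite ffunE (negPf ys) mulr0.
Qed.

End InjectiveExtension.

Section Act.
Context {R : comNzRingType} {X : finType}.

Lemma act_linear (A B : lmodType R) (g : {linear A -> B}) (D : X -> X -> R) (f : X -> A) s :
  act D (fun t => g (f t)) s = g (act D f s).
Proof. by rewrite linear_sum; apply: eq_bigr => t _; rewrite linearZ. Qed.

Lemma actP (A : lmodType R) (D : X -> X -> R) (a : R) (f g : X -> A) s :
  act D (fun t => a *: f t + g t) s = a *: act D f s + act D g s.
Proof.
rewrite scaler_sumr -big_split; apply: eq_bigr => t _ /=.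
by rewrite scalerDr !scalerA mulrC.
Qed.

Lemma actB (A : lmodType R) (D : X -> X -> R) (f g : X -> A) s :
  act D (fun t => f t - g t) s = act D f s - act D g s.
Proof. by rewrite -sumrB; apply: eq_bigr => t _; rewrite scalerBr. Qed.

Lemma eq_act (A : lmodType R) (D : X -> X -> R) (f g : X -> A) s :
  f =1 g -> act D f s = act D g s.
Proof. by move=> fg; apply: eq_bigr => t _; rewrite fg. Qed.

Lemma act0 (A : lmodType R) (D : X -> X -> R) (f : X -> A) s :
  (forall t, f t = 0) -> act D f s = 0.
Proof. by move=> f0; rewrite /act big1// => t _; rewrite f0 scaler0. Qed.

End Act.

Section Resolution.
Context {R : comNzRingType} {M : lmodType R} (E : injective_resolution M).

Lemma res_diff_diff q (v : res_obj E q) : res_diff E q.+1 (res_diff E q v) = 0.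
Proof.
apply/eqP; have := @res_exact _ _ E q (res_diff E q v); rewrite inE => ->.
by apply/asboolP; exists v.
Qed.

Lemma res_diff_aug (v : M) : res_diff E 0 (res_aug E v) = 0.
Proof.
apply/eqP; have := @res_exact0 _ _ E (res_aug E v); rewrite inE => ->.
by apply/asboolP; exists v.
Qed.

Lemma res_diff_exact q (u : res_obj E q.+1) : res_diff E q.+1 u = 0 ->
  exists v, res_diff E q v = u.
Proof.
by move=> u0; have := @res_exact _ _ E q u; rewrite inE u0 eqxx => /esym/asboolP.
Qed.

Lemma res_aug_exact (u : res_obj E 0) : res_diff E 0 u = 0 ->
  exists v, res_aug E v = u.
Proof.
by move=> u0; have := @res_exact0 _ _ E u; rewrite inE u0 eqxx => /esym/asboolP.
Qed.

End Resolution.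

(** * Diagram chasing between an injective resolution and a finite complex *)

Section Zigzag.
Context {R : comNzRingType} {M : lmodType R} (E : injective_resolution M).
Context {X : finType} (deg : X -> nat).

Definition hom_deg (A : zmodType) (p : nat) (f : X -> A) :=
  forall x, deg x != p -> f x = 0.

(* [zigzag D q p u c]: in the double complex Hom(T_p, E^q), with horizontal
   differential [act D], the cocycle [u] in bidegree (p, q) is cohomologous in the total
   complex, up to sign, to the cochain [c] of Hom(T_(p + q), M). *)
Fixpoint zigzag (D : X -> X -> R) (q p : nat) : (X -> res_obj E q) -> (X -> M) -> Prop :=
  match q with
  | 0 => fun u c => hom_deg p c /\ forall x, u x = res_aug E (c x)
  | q'.+1 => fun u c => exists w : X -> res_obj E q',
      [/\ hom_deg p w, forall x, u x = res_diff E q' (w x) &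
          @zigzag D q' p.+1 (act D w) c]
  end.

Lemma zigzag_lin D q p a u c u' c' : zigzag D p u c -> zigzag D p u' c' ->
  @zigzag D q p (fun x => a *: u x + u' x) (fun x => a *: c x + c' x).
Proof.
elim: q p u c u' c' => [|q IH] p u c u' c' /=.
  move=> [hc uc] [hc' uc']; split=> [x px|x]; first by rewrite hc// hc'// scaler0 addr0.
  by rewrite linearP -uc -uc'.
move=> [w [hw uw zw]] [w' [hw' uw' zw']]; exists (fun x => a *: w x + w' x); split.
- by move=> x px; rewrite hw// hw'// scaler0 addr0.
- by move=> x; rewrite linearP -uw -uw'.
rewrite (_ : act D _ = fun x => a *: act D w x + act D w' x); first exact: IH.
by apply: funext => x; rewrite actP.
Qed.

Lemma zigzag_map D D' (th : X -> R) q p u c :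
  (forall (A : lmodType R) (f : X -> A) s,
     act D' (fun t => th t *: f t) s = th s *: act D f s) ->
  zigzag D p u c -> @zigzag D' q p (fun x => th x *: u x) (fun x => th x *: c x).
Proof.
move=> DD'; elim: q p u c => [|q IH] p u c /=.
  move=> [hc uc]; split=> [x px|x]; first by rewrite hc// scaler0.
  by rewrite linearZ/= -uc.
move=> [w [hw uw zw]]; exists (fun x => th x *: w x); split.
- by move=> x px; rewrite hw// scaler0.
- by move=> x; rewrite linearZ/= -uw.
by rewrite (_ : act D' _ = fun x => th x *: act D w x); [exact: IH | apply: funext => x].
Qed.

Variable D : X -> X -> R.
Hypothesis D_deg : forall s t, D s t != 0 -> deg s = (deg t).+1.
Hypothesis D_comp : forall (A : lmodType R) (f : X -> A) s, act D (act D f) s = 0.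

Lemma act_hom (A : lmodType R) p (f : X -> A) : hom_deg p f -> hom_deg p.+1 (act D f).
Proof.
move=> hf s sp; rewrite /act big1// => t _.
have [->|/D_deg st] := eqVneq (D s t) 0; first by rewrite scale0r.
by rewrite hf ?scaler0//; apply: contraNneq sp => <-; rewrite st.
Qed.

(** The lifts come from exactness of [E]; the way back, [zigzag_bwd], takes them from exactness of
    [D]. With [zigzag_bound] and [zigzag_cobound0], which carry coboundaries across, this compares
    the two cohomologies element by element. *)
Lemma zigzag_fwd q p (u : X -> res_obj E q) : hom_deg p u ->
  (forall x, res_diff E q (u x) = 0) -> (forall s, act D u s = 0) ->
  exists c : X -> M, [/\ hom_deg (q + p) c, forall s, act D c s = 0 & zigzag D p u c].
Proof.
elim: q p u => [|q IH] p u hu du Du.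
  have /choice[c cE] x := res_aug_exact (du x).
  have hc : hom_deg p c.
    by move=> x px; apply: (res_aug_inj (i := E)); rewrite cE hu// raddf0.
  exists c; split=> //=; last by split=> // x; rewrite cE.
  move=> s; apply: (res_aug_inj (i := E)).
  by rewrite -act_linear raddf0 -[RHS](Du s); apply: eq_act.
have /choice[w wE] x : exists w, u x = res_diff E q w /\ (deg x != p -> w = 0).
  case: (altP (deg x =P p)) => [_|px].
    by have [w wE] := res_diff_exact (du x); exists w.
  by exists 0; rewrite raddf0 hu.
have hw : hom_deg p w by move=> x px; apply: (proj2 (wE x)).
have [||c [hc Dc zc]] := IH p.+1 (act D w) (act_hom hw).
- by move=> s; rewrite -act_linear -[RHS](Du s); apply: eq_act => x; case: (wE x).
- by move=> s; apply: D_comp.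
exists c; split=> //; first by rewrite addSnnS.
by exists w; split=> // x; case: (wE x).
Qed.

Lemma zigzag_bound q p (u : X -> res_obj E q.+1) (c : X -> M) (v : X -> res_obj E q) :
  zigzag D p u c -> (forall x, u x = res_diff E q (v x)) -> (forall s, act D v s = 0) ->
  exists b : X -> M, forall s, c s = act D b s.
Proof.
elim: q p u v => [|q IH] p u v /= [w [hw uw zw]] uv Dv.
  case: zw => hc wc.
  have /choice[b bE] x : exists b, res_aug E b = w x - v x.
    by apply: res_aug_exact; rewrite linearB -uw -uv subrr.
  exists b => s; apply: (res_aug_inj (i := E)).
  rewrite -act_linear -wc -[LHS]subr0 -(Dv s) -actB.
  by apply: eq_act => x; rewrite bE.
have /choice[b bE] x : exists b, res_diff E q b = w x - v x.
  by apply: res_diff_exact; rewrite linearB -uw -uv subrr.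
apply: (IH p.+1 (act D w) (act D b)) => [//|s|s].
  rewrite -act_linear -[LHS]subr0 -(Dv s) -actB.
  by apply: eq_act => x; rewrite bE.
exact: D_comp.
Qed.

Hypothesis D_exact : forall q (w : X -> res_obj E q), (forall s, act D w s = 0) ->
  (forall x, deg x = 0%N -> w x = 0) ->
  exists v : X -> res_obj E q, forall s, w s = act D v s.

Lemma hom_exact q p (w : X -> res_obj E q) : hom_deg p.+1 w ->
  (forall s, act D w s = 0) ->
  exists2 v : X -> res_obj E q, hom_deg p v & forall s, w s = act D v s.
Proof.
move=> hw Dw; have [x x0|v vE] := D_exact Dw; first by rewrite hw// x0.
exists (fun x => if deg x == p then v x else 0) => [x /negPf->//|s].
have [sp|sp] := eqVneq (deg s) p.+1.
  rewrite vE; apply: eq_bigr => t _; case: ifP => // tp.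
  have [->|/D_deg] := eqVneq (D s t) 0; first by rewrite !scale0r.
  by rewrite sp => -[pt]; rewrite pt eqxx in tp.
rewrite hw// /act big1// => t _.
have [->|/D_deg st] := eqVneq (D s t) 0; first by rewrite scale0r.
case: ifP => [/eqP tp|_]; last by rewrite scaler0.
by rewrite st tp eqxx in sp.
Qed.

Lemma zigzag_bwd q p (c : X -> M) : hom_deg (q + p) c -> (forall s, act D c s = 0) ->
  exists u : X -> res_obj E q,
    [/\ hom_deg p u, forall s, act D u s = 0,
        forall x, res_diff E q (u x) = 0 & zigzag D p u c].
Proof.
elim: q p => [|q IH] p hc Dc.
  exists (fun x => res_aug E (c x)); split=> //.
  - by move=> x px; rewrite hc// raddf0.
  - by move=> s; rewrite act_linear Dc raddf0.
  - by move=> x; apply: res_diff_aug.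
have [|u [hu Du du zu]] := IH p.+1 _ Dc; first by rewrite addnS.
have [w hw wE] := hom_exact hu Du.
exists (fun x => res_diff E q (w x)); split.
- by move=> x px; rewrite hw// raddf0.
- by move=> s; rewrite act_linear -wE.
- by move=> x; apply: res_diff_diff.
exists w; split=> //; rewrite (_ : act D w = u)//.
by apply: funext => s; rewrite -wE.
Qed.

(** The dual of [zigzag_bound]: each w is corrected by the s found one step further and becomes a
    cocycle for [D], hence a coboundary. *)
Lemma zigzag_cobound q p (u : X -> res_obj E q) (b : X -> M) :
  zigzag D p.+1 u (act D b) -> hom_deg (q + p) b ->
  exists s : X -> res_obj E q,
    [/\ hom_deg p s, forall x, res_diff E q (s x) = 0 & forall x, u x = act D s x].
Proof.
elim: q p u => [|q IH] p u /=.
  move=> [_ uc] hb; exists (fun x => res_aug E (b x)); split=> x.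
  - by move=> /hb->; rewrite raddf0.
  - exact: res_diff_aug.
  - by rewrite uc act_linear.
move=> [w [hw uw zw]] hb.
have [|s [hs ds ws]] := IH p.+1 _ zw; first by rewrite addnS.
have [|x|s1 hs1 s1E] := @hom_exact q p (fun x => w x - s x).
- by move=> x px; rewrite hw// hs// subr0.
- by rewrite actB ws subrr.
exists (fun x => res_diff E q (s1 x)); split=> x.
- by move=> px; rewrite hs1// raddf0.
- exact: res_diff_diff.
- by rewrite act_linear -s1E linearB ds subr0.
Qed.

Lemma zigzag_cobound0 q (u : X -> res_obj E q.+1) (b : X -> M) :
  zigzag D 0 u (act D b) -> hom_deg q b ->
  exists s : X -> res_obj E q,
    (forall x, act D s x = 0) /\ forall x, u x = res_diff E q (s x).
Proof.
move=> [w [hw uw zw]] hb.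
have [|s [hs ds ws]] := zigzag_cobound zw; first by rewrite addn0.
exists (fun x => w x - s x); split=> x; first by rewrite actB ws subrr.
by rewrite linearB ds subr0.
Qed.

End Zigzag.

(** * Linear algebra over the coefficient field *)

Lemma enum_ext (T : finType) (k : nzRingType) (U : {set T}) (f : 'I_#|U| -> k) :
  exists g : T -> k, forall a, g (enum_val a) = f a.
Proof.
exists (fun x => if [pick a | enum_val a == x] is Some a then f a else 0) => a.
by case: pickP => [b /eqP/enum_val_inj->|/(_ a)]//; rewrite eqxx.
Qed.

Lemma big_enum_val_set (T : finType) (k : nzRingType) (U : {set T}) (F : T -> k) :
  \sum_(t in U) F t = \sum_(a < #|U|) F (enum_val a).
Proof. exact: big_enum_val. Qed.

Section Pairing.
Context {k : fieldType} {X : finType} (D : X -> X -> k) (U0 U U2 : {set X}).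

(** The matrix kermx M *m cokermx N pairs the functionals killing coboundaries with the cocycles. If
    it vanishes, the rows of kermx M, among them those of 1 - M (pinvmx M), factor through N, which
    yields a contraction; otherwise a nonzero entry is scaled to 1. *)
Lemma exact_or_pairing :
  (exists P Q : X -> X -> k, forall s t, s \in U -> t \in U ->
     (s == t)%:R = \sum_(r in U0) D s r * P r t + \sum_(r in U2) Q s r * D r t) \/
  (exists zeta phi : X -> k,
    [/\ forall s, s \in U2 -> \sum_(t in U) D s t * zeta t = 0,
        forall r, r \in U0 -> \sum_(t in U) phi t * D t r = 0 &
        \sum_(t in U) phi t * zeta t = 1]).
Proof.
pose N := \matrix_(a < #|U2|, b < #|U|) D (enum_val a) (enum_val b).
pose M := \matrix_(a < #|U|, b < #|U0|) D (enum_val a) (enum_val b).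
have [K0|KN0] := eqVneq (kermx M *m cokermx N) 0.
  left; have /submxP[W KW] : (kermx M <= N)%MS by rewrite submxE K0.
  have /submxP[Z ZE] : (1%:M - M *m pinvmx M <= kermx M)%MS.
    by apply/sub_kermxP; rewrite mulmxBl mul1mx mulmxKpV ?subrr.
  have E1 : 1%:M = M *m pinvmx M + Z *m W *m N.
    by rewrite -mulmxA -KW -ZE addrC subrK.
  have /choice[P' P'E] : forall b : 'I_#|U|, exists g : X -> k,
      forall a, g (enum_val a) = pinvmx M a b.
    by move=> b; apply: enum_ext.
  have /choice[Q' Q'E] : forall a : 'I_#|U|, exists g : X -> k,
      forall b, g (enum_val b) = (Z *m W) a b.
    by move=> a; apply: enum_ext.
  exists (fun r t => if [pick b | enum_val b == t] is Some b then P' b r else 0).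
  exists (fun s r => if [pick a | enum_val a == s] is Some a then Q' a r else 0).
  move=> s t sU tU; rewrite -(enum_rankK_in sU sU) -(enum_rankK_in tU tU).
  set a := enum_rank_in _ _; set b := enum_rank_in _ _.
  have pickE (c : 'I_#|U|) : [pick b0 | enum_val b0 == enum_val c] = Some c.
    by case: pickP => [c' /eqP/enum_val_inj->|/(_ c)]//; rewrite eqxx.
  rewrite !pickE !big_enum_val_set.
  transitivity ((1%:M : 'M[k]_#|U|) a b).
    by rewrite !mxE (inj_eq enum_val_inj).
  rewrite E1 mxE; congr (_ + _); rewrite mxE; apply: eq_bigr => c _.
    by rewrite mxE P'E.
  by rewrite [N _ _]mxE -Q'E.
right; have [a [b ab]] : exists a b, (kermx M *m cokermx N) a b != 0.
  apply: contrapT => nab; case/negP: KN0; apply/eqP/matrixP => a b; rewrite [RHS]mxE.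
  by apply: contrapT => /eqP ab; apply: nab; exists a, b.
have [phi phiE] := enum_ext (kermx M a).
have [zeta zetaE] := enum_ext (fun c => cokermx N c b / (kermx M *m cokermx N) a b).
exists zeta, phi; split=> [s sU|r rU|].
- rewrite big_enum_val_set -(enum_rankK_in sU sU); set c := enum_rank_in _ _.
  rewrite (eq_bigr (fun e => N c e * cokermx N e b / (kermx M *m cokermx N) a b)).
    rewrite -mulr_suml; have /matrixP/(_ c b) := mulmx_coker N.
    by rewrite [LHS]mxE [RHS]mxE => ->; rewrite mul0r.
  by move=> e _; rewrite zetaE [N _ _]mxE mulrA.
- rewrite big_enum_val_set -(enum_rankK_in rU rU); set c := enum_rank_in _ _.
  have /matrixP/(_ a c) := mulmx_ker M; rewrite [LHS]mxE [RHS]mxE => E0.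
  by rewrite -[RHS]E0; apply: eq_bigr => e _; rewrite phiE [M _ _]mxE.
rewrite big_enum_val_set -(divff ab) [X in _ = X / _]mxE mulr_suml.
by apply: eq_bigr => e _; rewrite phiE zetaE mulrA.
Qed.

(** S picks preimages of coboundaries linearly; [cocycle_decomposition] uses it to correct a cochain
    into a cocycle without enlarging its support. *)
Lemma generalized_inverse : exists S : X -> X -> k, forall s t, s \in U2 -> t \in U ->
  D s t = \sum_(a in U) \sum_(b in U2) D s a * S a b * D b t.
Proof.
pose N := \matrix_(a < #|U2|, b < #|U|) D (enum_val a) (enum_val b).
have /choice[S' S'E] : forall b : 'I_#|U|, exists g : X -> k,
    forall a, g (enum_val a) = pinvmx N b a.
  by move=> b; apply: enum_ext.
exists (fun s r => if [pick a | enum_val a == s] is Some a then S' a r else 0).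
move=> s t sU tU; rewrite -(enum_rankK_in sU sU) -(enum_rankK_in tU tU).
set a := enum_rank_in _ _; set b := enum_rank_in _ _.
have pickE (c : 'I_#|U|) : [pick b0 | enum_val b0 == enum_val c] = Some c.
  by case: pickP => [c' /eqP/enum_val_inj->|/(_ c)]//; rewrite eqxx.
have /matrixP/(_ a b) : N *m pinvmx N *m N = N by rewrite mulmxKpV.
rewrite [in RHS]mxE => <-; rewrite mxE big_enum_val_set.
under [RHS]eq_bigr do rewrite big_enum_val_set.
rewrite exchange_big; apply: eq_bigr => e _ /=; rewrite mxE mulr_suml.
by apply: eq_bigr => c _; rewrite pickE S'E [N a c]mxE [N e b]mxE.
Qed.

End Pairing.

Section Decomposition.
Context {R : comNzRingType} {k : fieldType} (iota : {rmorphism k -> R}).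
Context {d s : nat} (A : 'I_s -> {set 'I_d}) (i : nat).
Implicit Types (N H : {set 'I_d}) (sg tau rho : {set 'I_s}).

(** The sets whose union contains N are stable under enlargement: they form a subcomplex of the
    cochains but a quotient of the chains. So zeta is a cocycle of the whole simplex, while phi is
    tested only on faces with N in their union. *)
Definition pairing N := exists phi zeta : {set 'I_s} -> R,
  [/\ forall sg, ~~ ((#|sg| == i) && (N \subset cup A sg)) -> phi sg = 0 /\ zeta sg = 0,
      forall tau, N \subset cup A tau -> \sum_sg phi sg * incid sg tau = 0,
      forall rho, \sum_tau incid rho tau * zeta tau = 0 &
      \sum_sg phi sg * zeta sg = 1].

Lemma rmorph_incid sg tau : iota (incid sg tau) = incid sg tau.
Proof.
rewrite /incid rmorph_sum; apply: eq_bigr => a _.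
by rewrite rmorphM rmorph_nat /sgn rmorphXn rmorphN rmorph1.
Qed.

Lemma incid_eq0 sg tau :
  ~~ ((tau \subset sg) && (#|sg| == #|tau|.+1)) -> (incid sg tau : R) = 0.
Proof. by move=> h; apply/eqP; apply: contraNT h => /incid_sub. Qed.

Lemma contraction_or_pairing N :
  contraction_at (fun sg => ~: cup A sg) (@incid R s) (fun sg => #|sg| == i) (~: N) \/
  pairing N.
Proof.
pose V j := [set sg : {set 'I_s} | (#|sg| == j) && (N \subset cup A sg)].
(* The successor makes [U0] empty for i = 0, where i.-1 would not. *)
pose U := V i; pose U0 := [set sg : {set 'I_s} | (#|sg|.+1 == i) && (N \subset cup A sg)].
have [[P [Q PQ]]|[zeta [phi [hz hp zp]]]] := exact_or_pairing (@incid k s) U0 U (V i.+1).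
  left; exists (fun sg tau => if sg \in U0 then iota (P sg tau) else 0).
  exists (fun sg tau => if (sg \in U) && (tau \in V i.+1) then iota (Q sg tau) else 0).
  split=> [sg tau|sg tau|p p0 sg].
  - by rewrite setCS => /negPf nN; rewrite inE nN andbF.
  - by rewrite setCS inE => /negPf->.
  have pU tau : tau \notin U -> p tau = 0.
    by rewrite inE => nU; apply: p0; rewrite setCS.
  have [sgU|sgU] := boolP (sg \in U); last first.
    rewrite pU// [X in X + _]/ract [X in _ + X]/ract [X in _ + X]big1 ?addr0 => [|tau _].
      2: by rewrite (negPf sgU) mul0r.
    rewrite big1// => tau _; rewrite /ract; case: (boolP (tau \in U0)) => tauU; last first.
      by rewrite big1 ?mulr0// => rho _; rewrite mul0r.
    rewrite incid_eq0 ?mul0r//; apply: contra sgU => /andP[ts /eqP sgE].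
    move: tauU; rewrite !inE sgE => /andP[-> Nt].
    exact: subset_trans Nt (cup_subset A ts).
  transitivity (\sum_(t in U) iota (sg == t)%:R * p t).
    rewrite (bigD1 sg)//= eqxx rmorph1 mul1r big1 ?addr0// => t /andP[_ /negPf ts].
    by rewrite eq_sym ts rmorph0 mul0r.
  rewrite (eq_bigr (fun t =>
     \sum_rho (if rho \in U0 then iota (incid sg rho * P rho t) * p t else 0) +
     \sum_rho (if rho \in V i.+1 then iota (Q sg rho * incid rho t) * p t else 0))); last first.
    move=> t tU; rewrite (PQ _ _ sgU tU) rmorphD !rmorph_sum mulrDl !mulr_suml.
    by congr (_ + _); rewrite [LHS]big_mkcond.
  rewrite big_split/=; congr (_ + _).
    rewrite exchange_big; apply: eq_bigr => rho _ /=; rewrite /ract.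
    case: (rho \in U0); last first.
      by rewrite [LHS]big1// big1 ?mulr0// => t _; rewrite mul0r.
    rewrite mulr_sumr big_mkcond; apply: eq_bigr => t _.
    case: ifP => tU; last by rewrite pU ?tU// !mulr0.
    by rewrite rmorphM rmorph_incid mulrA.
  rewrite exchange_big; apply: eq_bigr => rho _ /=; rewrite sgU/=.
  case: (rho \in V i.+1); last by rewrite big1// mul0r.
  rewrite /ract mulr_sumr big_mkcond; apply: eq_bigr => t _.
  case: ifP => tU; last by rewrite pU ?tU// !mulr0.
  by rewrite rmorphM rmorph_incid mulrA.
right; exists (fun sg => if sg \in U then iota (phi sg) else 0).
exists (fun sg => if sg \in U then iota (zeta sg) else 0); split=> [sg|tau Nt|rho|].
- by rewrite inE => /negPf->.
- rewrite (eq_bigr (fun sg => if sg \in U then iota (phi sg * incid sg tau) else 0)); last first.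
    by move=> sg _; case: ifP; rewrite ?mul0r// rmorphM rmorph_incid.
  rewrite -big_mkcond/= -rmorph_sum.
  have [tU|tU] := boolP (tau \in U0); first by rewrite hp// rmorph0.
  rewrite rmorph_sum big1// => sg sgU; rewrite rmorphM rmorph_incid incid_eq0 ?mulr0//.
  apply: contra tU => /andP[_ /eqP sE]; rewrite inE Nt -sE andbT.
  by move: sgU; rewrite inE => /andP[].
- rewrite (eq_bigr (fun sg => if sg \in U then iota (incid rho sg * zeta sg) else 0)); last first.
    by move=> sg _; case: ifP; rewrite ?mulr0// rmorphM rmorph_incid.
  rewrite -big_mkcond/= -rmorph_sum.
  have [rU|rU] := boolP (rho \in V i.+1); first by rewrite hz// rmorph0.
  rewrite rmorph_sum big1// => sg sgU; rewrite rmorphM rmorph_incid incid_eq0 ?mul0r//.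
  apply: contra rU => /andP[sr /eqP rE]; move: sgU; rewrite !inE rE eqSS => /andP[-> Ns].
  exact: subset_trans Ns (cup_subset A sr).
rewrite (eq_bigr (fun sg => if sg \in U then iota (phi sg * zeta sg) else 0)); last first.
  by move=> sg _; case: ifP; rewrite ?mul0r// rmorphM.
by rewrite -big_mkcond/= -rmorph_sum zp rmorph1.
Qed.

(* The faces supporting [p] involve every variable, so that [p] is divisible by all
   of them in the next complex of the direct system. *)
Lemma cocycle_decomposition (u : 'I_d -> R) (c : {set 'I_s} -> R) : perm_regular u ->
  (forall N, N != setT -> ~ pairing N) ->
  (forall sg, #|sg| != i -> c sg = 0) ->
  (forall sg, ract (taylor u A) c sg = 0) ->
  exists p b : {set 'I_s} -> R,
    [/\ forall sg, ~~ ((#|sg| == i) && (cup A sg == setT)) -> p sg = 0,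
        forall sg, ract incid p sg = 0 &
        forall sg, c sg = p sg + ract (taylor u A) b sg].
Proof.
move=> u_reg npair hc Dc.
pose ct sg := smon u (~: cup A sg) * c sg.
have Dct sg : ract incid ct sg = 0 by rewrite ract_incid Dc mulr0.
pose V j := [set sg : {set 'I_s} | (#|sg| == j) && (cup A sg == setT)].
have [S SE] := generalized_inverse (@incid k s) (V i) (V i.+1).
pose S' sg tau := if (sg \in V i) && (tau \in V i.+1) then iota (S sg tau) else 0.
pose q sg := if cup A sg == setT then ct sg else 0.
have qV sg : sg \notin V i -> q sg = 0.
  rewrite inE negb_and /q /ct; case: ifP => // _; rewrite orbF => /hc->.
  by rewrite mulr0.
(* The part q of [ct] on sets with full union need not be a cocycle; subtracting S D q makes it one,
   as D S D = D there. *)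
pose p sg := q sg - ract S' (ract incid q) sg.
have pV sg : sg \notin V i -> p sg = 0.
  move=> nV; rewrite /p qV// sub0r /ract big1 ?oppr0// => t _.
  by rewrite /S' (negPf nV) mul0r.
have up sg tau : tau \in V i -> sg \notin V i.+1 -> (incid sg tau : R) = 0.
  move=> tV sV; apply: incid_eq0; apply: contra sV => /andP[ts /eqP sE].
  move: tV; rewrite !inE sE eqSS => /andP[-> /eqP tT] /=.
  by rewrite eqEsubset subsetT -tT cup_subset.
have Dp sg : ract incid p sg = 0.
  have [sV|sV] := boolP (sg \in V i.+1); last first.
    rewrite /ract big1// => tau _; case: (boolP (tau \in V i)) => [tV|/pV->].
      by rewrite up// mul0r.
    by rewrite mulr0.
  rewrite ractB; apply/eqP; rewrite subr_eq0; apply/eqP.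
  transitivity (\sum_(t in V i) iota (incid sg t) * q t).
    rewrite big_mkcond; apply: eq_bigr => t _; rewrite rmorph_incid.
    by case: ifP => // /negbT/qV->; rewrite mulr0.
  rewrite (eq_bigr (fun t => \sum_a \sum_b incid sg a * S' a b * (incid b t * q t))); last first.
    move=> t tV; rewrite (SE _ _ sV tV) rmorph_sum mulr_suml big_mkcond.
    apply: eq_bigr => a _; case: ifP => aV; last first.
      by rewrite big1// => b _; rewrite /S' aV mulr0 mul0r.
    rewrite rmorph_sum mulr_suml big_mkcond; apply: eq_bigr => b _.
    rewrite /S' aV/=; case: ifP => bV; last by rewrite mulr0 mul0r.
    by rewrite !rmorphM !rmorph_incid mulrA.
  rewrite exchange_big; apply: eq_bigr => a _ /=; rewrite exchange_big/=.
  rewrite /ract mulr_sumr; apply: eq_bigr => b _.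
  rewrite -mulr_sumr [RHS]mulrA; congr (_ * _); rewrite big_mkcond.
  by apply: eq_bigr => t _; case: ifP => // /negbT/qV->; rewrite mulr0.
have Dq sg : ract incid q sg = - ract incid (fun t => ct t - q t) sg.
  by rewrite ractB Dct sub0r opprK.
have eH sg : ct sg - q sg \in
    gen (fun H => (H \in [set~ set0]) && (~: cup A sg \subset H)) (smon u).
  rewrite /q; case: (eqVneq (cup A sg) setT) => [_|nT]; first by rewrite subrr ideal0.
  rewrite subr0 /ct mulrC; apply: ideal_mull; apply: (mem_gen (j := ~: cup A sg)) => //.
  by rewrite subxx andbT in_setC1 -setCT (inj_eq (@setC_inj _)).
have [||||| b bE] := monomial_filtration u_reg (@ract_incid_comp R s) (U := [set~ set0])
   (L := fun sg => ~: cup A sg) (Y := fun sg => #|sg| == i) (c := fun sg => ct sg - p sg).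
- move=> H H'; rewrite !in_setC1 => H0 HH'; apply: contraNneq H0 => H'0.
  by rewrite -subset0 -H'0.
- move=> H; rewrite in_setC1 => H0; rewrite -[H]setCK.
  have [//|/npair[]] := contraction_or_pairing (~: H).
  by rewrite -setC0 (inj_eq (@setC_inj _)).
(* The correction is harmless: D q = - D (ct - q) as [ct] is a cocycle, so it also lies in the ideal
   of the nonempty monomials. *)
- move=> sg; rewrite /p opprB addrA addrAC; apply: idealD; first exact: eH.
  have [sV|sV] := boolP (sg \in V i); last first.
    by rewrite /ract big1 ?ideal0// => t _; rewrite /S' (negPf sV) mul0r.
  have sT : ~: cup A sg = set0 by move: sV; rewrite inE => /andP[_ /eqP->]; rewrite setCT.
  apply: ract_ideal => rho; rewrite Dq; apply/idealN/ract_ideal => t.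
  apply: gen_sub (eH t) => H /andP[H0 _]; apply: (mem_gen (j := H)) => //.
  by rewrite H0 sT sub0set.
- by move=> sg si; rewrite /ct hc// mulr0 sub0r pV ?oppr0// inE (negPf si).
- by move=> sg; rewrite ractB Dct Dp subr0.
exists p, b; split=> // [sg nV|sg]; first by rewrite pV// inE.
apply/eqP; rewrite -subr_eq0; apply/eqP; apply: (smon_lreg u_reg (H := ~: cup A sg)).
rewrite mulrBr mulrDr -ract_incid -bE -[_ * c sg]/(ct sg).
rewrite (_ : smon u _ * p sg = p sg); first by rewrite [p sg + _]addrC subrK subrr.
have [sV|/pV->] := boolP (sg \in V i); last by rewrite mulr0.
by move: sV; rewrite inE => /andP[_ /eqP->]; rewrite setCT smon0 mul1r.
Qed.

End Decomposition.

(** * Torsion and local cohomology classes *)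

Section TorsionGenerators.
Context {R : comNzRingType}.

Lemma ideal_pow_ann (J : ideal R) n (M : lmodType R) (v : M) :
  (forall f : 'I_n -> R, (forall t, f t \in J) -> (\prod_(t < n) f t) *: v = 0) ->
  forall a, a \in ideal_pow J n -> (a : R) *: v = 0.
Proof.
move=> fv; have cl : submod_closed ([pred a : R^o | (a : R) *: v == 0] : {pred R^o}).
  split=> [|a b c]; rewrite !inE; first by rewrite scale0r.
  by move=> /eqP bv /eqP cv; rewrite scalerDl -scalerA bv cv scaler0 addr0.
move=> a aJ; apply/eqP; apply: (span_sub (N := submod_of cl)) aJ => _ [f fJ ->].
by apply/eqP/fv.
Qed.

(** Pigeonhole: when a product of more than [\sum_t e t] elements of J is expanded in the g t, each
    term contains some g t at least e t times. *)
Lemma torsion_gen (J : ideal R) (T : finType) (g : T -> R) (M : lmodType R) (v : M)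
    (e : T -> nat) :
  {subset J <= gen (fun=> true) g} -> (forall t, g t ^+ e t *: v = 0) ->
  v \in torsion J M.
Proof.
move=> Jg ev; apply/asboolP; exists (\sum_t e t).+1; apply: ideal_pow_ann.
move: {-1}(\sum_t e t)%N (leqnn (\sum_t e t)%N) => n; elim: n e v ev => [|n IH] e v ev en f fJ.
  have /genP[c cE] := Jg _ (fJ ord0).
  rewrite big_ord_recl mulrC -scalerA cE scaler_suml [X in _ *: X]big1 ?scaler0// => t _.
  rewrite -scalerA; have := ev t.
  rewrite (_ : e t = 0%N) ?scale1r => [->|]; first by rewrite !scaler0.
  by apply/eqP; rewrite -leqn0 (leq_trans _ en)// (bigD1 t)//= leq_addr.
have /genP[c cE] := Jg _ (fJ ord0).
rewrite big_ord_recl mulrC -scalerA cE scaler_suml scaler_sumr big1// => t _.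
rewrite -scalerA scalerA mulrC -scalerA.
case et : (e t) => [|p].
  by have := ev t; rewrite et scale1r => ->; rewrite !scaler0.
rewrite [X in _ *: X](IH (fun t' => if t' == t then p else e t')) ?scaler0//.
- move=> t'; case: eqP => [->|_]; first by rewrite scalerA -exprSr -et.
  by rewrite scalerA mulrC -scalerA ev scaler0.
rewrite (bigD1 t)//= eqxx; move: en; rewrite (bigD1 t)//= et addSn ltnS; apply: leq_trans.
rewrite leq_add2l leq_eqVlt; apply/orP; left; apply/eqP.
by apply: eq_bigr => t' /negPf->.
Qed.

Lemma torsion_ann (J : ideal R) (M : lmodType R) (v : M) :
  v \in torsion J M -> exists n, forall a : R, a \in J -> a ^+ n *: v = 0.
Proof.
move=> /asboolP[n nv]; exists n => a aJ; apply: nv; apply: mem_span.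
by exists (fun=> a) => //; rewrite prodr_const card_ord.
Qed.

Lemma torsion_sop (m : ideal R) (d : nat) (x : 'I_d -> R) (M : lmodType R) (v : M) n :
  noetherian R -> system_of_parameters m x ->
  (forall j, x j ^+ n *: v = 0) -> v \in torsion m M.
Proof.
move=> nR [_ xm] xv; have [l lE] := nR m.
have vx : v \in torsion (gen (fun=> true) x) M by apply: (torsion_gen (g := x) (e := fun=> n)).
have [p pv] := torsion_ann vx.
have /choice[e eP] (t : 'I_(size l)) : exists e, l`_t ^+ e *: v = 0.
  have /xm[q qx] : l`_t \in m by rewrite lE; apply: mem_span; rewrite /= mem_nth.
  by exists (q * p)%N; rewrite exprM; apply/pv/span_range.
apply: (torsion_gen (g := fun t : 'I_(size l) => l`_t) (e := e)) eP => r; rewrite lE.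
apply: span_sub => a /= /(nthP 0)[t tl <-].
exact: (mem_gen (j := Ordinal tl)).
Qed.

(* The increasing chain of the kernels of the powers of [a] stabilizes. *)
Lemma finite_length_kill (H : lmodType R) (a : R) : finite_length H ->
  (forall h : H, exists n, a ^+ n *: h = 0) -> exists t, forall h : H, a ^+ t *: h = 0.
Proof.
move=> [l lH] aH.
have cl n : submod_closed ([pred h : H | a ^+ n *: h == 0] : {pred H}).
  split=> [|b u v]; rewrite !inE; first by rewrite scaler0.
  move=> /eqP un /eqP vn.
  by rewrite scalerDr scalerA mulrC -scalerA un vn scaler0 addr0.
pose K n := submod_of (cl n).
have KS n : {subset K n <= K n.+1}.
  by move=> h /eqP hn; apply/eqP; rewrite exprS -scalerA hn scaler0.
have [t Kt] : exists t, {subset K t.+1 <= K t}.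
  apply: contrapT => nK; have := lH l.+1 K; rewrite ltnn; suff chain j : submod_lt (K j) (K j.+1).
    by move=> /(_ (fun j _ => chain j)).
  by split=> [|Kj]; [exact: KS | apply: nK; exists j].
exists t => h; have [n] := aH h.
suff : a ^+ (n + t) *: h = 0 -> a ^+ t *: h = 0.
  by move=> + hn; apply; rewrite addnC exprD -scalerA hn scaler0.
elim: n => [|n IH] //; rewrite addSn => hn; apply: IH.
suff Kn p : {subset K (p + t).+1 <= K (p + t)%N} by apply/eqP; apply: Kn; apply/eqP.
elim: p => [|p IH] // h' /eqP h'n; apply/eqP; rewrite addSn exprSr -scalerA.
by apply/eqP; apply: IH; apply/eqP; rewrite scalerA -exprSr -addSn.
Qed.

End TorsionGenerators.

Section LocalCohomologyClasses.
Context {R : comNzRingType} (J : ideal R) {M : lmodType R} (E : injective_resolution M).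

(** Representatives in the resolution replace classes, so that the nested subtypes and the quotient
    are opened in this section only. *)
Definition lc_rep i (h : local_cohomology J E i) (v : res_obj E i) :=
  exists z : submod (kernel (torsion_diff J E i)),
    h = quotmod_pi _ z /\ submod_val (submod_val z) = v.

Definition lc_bound i : res_obj E i -> Prop :=
  match i with
  | 0 => fun w => w = 0
  | i'.+1 => fun w => exists2 u, u \in torsion J (res_obj E i') & res_diff E i' u = w
  end.

Lemma lc_rep_ex i (h : local_cohomology J E i) : exists v, lc_rep h v.
Proof.
by have [z zE] := quotmod_piP h; exists (submod_val (submod_val z)), z.
Qed.

Lemma lc_rep_mk i (v : res_obj E i) : v \in torsion J (res_obj E i) ->
  res_diff E i v = 0 -> exists h : local_cohomology J E i, lc_rep h v.
Proof.
move=> tv dv.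
have kz : (Submod tv : torsion_obj J E i) \in kernel (torsion_diff J E i).
  by rewrite inE; apply/eqP; apply: val_inj.
by exists (quotmod_pi _ (Submod kz)), (Submod kz).
Qed.

Lemma lc_repP i (h : local_cohomology J E i) v : lc_rep h v ->
  v \in torsion J (res_obj E i) /\ res_diff E i v = 0.
Proof.
move=> [z [_ <-]]; split; first exact: submod_valP.
have := submod_valP z; rewrite inE => /eqP dz.
by rewrite -[LHS]/(submod_val (torsion_diff J E i (submod_val z))) dz.
Qed.

Lemma lc_repZ i a (h : local_cohomology J E i) v : lc_rep h v -> lc_rep (a *: h) (a *: v).
Proof.
by move=> [z [-> <-]]; exists (a *: z); split; rewrite !linearZ.
Qed.

Lemma lc_rep_eq i (h h' : local_cohomology J E i) v v' : lc_rep h v -> lc_rep h' v' ->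
  h = h' <-> lc_bound (v - v').
Proof.
move=> [z [-> <-]] [z' [-> <-]]; rewrite quotmod_pi_eq.
rewrite (_ : _ - submod_val _ = submod_val (submod_val (z - z'))); last first.
  by rewrite !linearB.
rewrite [_ \in _](_ : _ = (submod_val (z - z') \in coboundaries J E i))//.
move: (submod_val (z - z')); clear z z' h h' v v'; case: i => [|i] w /=.
  rewrite inE; split=> [/eqP->//|w0]; apply/eqP; exact: val_inj.
split=> [/asboolP[u <-]|[u tu uw]]; first by exists (submod_val u) => //; apply: submod_valP.
by apply/asboolP; exists (Submod tu); apply: val_inj.
Qed.

End LocalCohomologyClasses.

(** * Divisibility of the local cohomology of R *)

Section TaylorCochains.
Context {R : comNzRingType} {d s : nat} (A : 'I_s -> {set 'I_d}).
Local Notation deg := (fun sg : {set 'I_s} => #|sg|).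

Definition point (M : zmodType) (v : M) (sg : {set 'I_s}) : M :=
  if sg == set0 then v else 0.

Lemma hom_point (M : zmodType) (v : M) : hom_deg deg 0 (point v).
Proof. by move=> sg; rewrite cards_eq0 /point => /negPf->. Qed.

Lemma act_taylor_set1 (u : 'I_d -> R) (M : lmodType R) (f : {set 'I_s} -> M) a :
  act (taylor u A) f [set a] = smon u (A a) *: f set0.
Proof.
rewrite /act (bigD1 set0)//= big1 => [|tau t0].
  by rewrite addr0 /taylor incid_set1 mul1r cup0 cup_set1 setD0.
have [->|/taylor_nz[_]] := eqVneq (taylor u A [set a] tau) 0; first by rewrite scale0r.
by rewrite cards1 => -[/esym/eqP]; rewrite cards_eq0 (negPf t0).
Qed.

Lemma act_taylor_point (u : 'I_d -> R) (M : lmodType R) (v : M) :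
  (forall a, smon u (A a) *: v = 0) -> forall sg, act (taylor u A) (point v) sg = 0.
Proof.
move=> uv sg; have [/cards1P[a ->]|s1] := boolP (#|sg| == 1%N).
  by rewrite act_taylor_set1 /point eqxx.
rewrite /act big1// => tau _; rewrite /point; case: eqP => [->|_]; last by rewrite scaler0.
have [->|/taylor_nz[_ sE]] := eqVneq (taylor u A sg set0) 0; first by rewrite scale0r.
by rewrite sE cards0 in s1.
Qed.

Lemma taylor_deg (u : 'I_d -> R) (sg tau : {set 'I_s}) :
  taylor u A sg tau != 0 -> #|sg| = #|tau|.+1.
Proof. by move=> /taylor_nz[]. Qed.

Lemma taylor_cochain_exact (u : 'I_d -> R) (E : lmodType R) (w : {set 'I_s} -> E) :
  perm_regular u -> injective_module E ->
  (forall sg, act (taylor u A) w sg = 0) -> (forall sg : {set 'I_s}, #|sg| = 0%N -> w sg = 0) ->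
  exists v : {set 'I_s} -> E, forall sg, w sg = act (taylor u A) v sg.
Proof.
move=> u_reg injE Dw w0; apply: (cochain_exact (x0 := set0)) => //.
- by move=> f f0 fs; apply: taylor_exact.
- move=> tau; apply/eqP; apply: contraT => /taylor_nz[_].
  by rewrite cards0.
- by apply: w0; rewrite cards0.
Qed.

Lemma smonX (x : 'I_d -> R) n (H : {set 'I_d}) :
  smon (fun j => x j ^+ n) H = smon x H ^+ n.
Proof. by rewrite /smon prodrXl. Qed.

End TaylorCochains.

Section Surjectivity.
Context {R : comNzRingType} {k : fieldType} (iota : {rmorphism k -> R}).
Context {d s : nat} (x : 'I_d -> R) (A : 'I_s -> {set 'I_d}) (I : ideal R) (i : nat).
Local Notation deg := (fun sg : {set 'I_s} => #|sg|).

Lemma zigzag_lc_bound (u : 'I_d -> R) (M : lmodType R) (E : injective_resolution M) q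
    (w : res_obj E q) (b : {set 'I_s} -> M) : perm_regular u ->
  (forall q (w : res_obj E q), (forall a, smon u (A a) *: w = 0) ->
     w \in torsion I (res_obj E q)) ->
  zigzag (E := E) deg (taylor u A) 0 (point w) (act (taylor u A) b) ->
  (forall sg : {set 'I_s}, #|sg|.+1 != q -> b sg = 0) ->
  lc_bound I w.
Proof.
move=> u_reg tor; case: q w => [|q] w zw hb /=.
  case: zw => _ /(_ set0); rewrite /point eqxx => ->.
  by rewrite act0 ?raddf0// => sg; rewrite hb.
have [||g [Dg gE]] := zigzag_cobound0 (@taylor_deg _ _ _ A u) _ zw.
- by move=> q' w'; apply: taylor_cochain_exact => //; apply: res_injective.
- by move=> sg; apply: hb.
exists (g set0); last by rewrite -gE /point eqxx.
by apply: tor => a; rewrite -act_taylor_set1 Dg.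
Qed.

Lemma local_cohomology_divisible (E : injective_resolution (R^o : lmodType R)) :
  (forall n, perm_regular (fun j => x j ^+ n.+1)) ->
  I =i gen (fun=> true) (fun a => smon x (A a)) ->
  (forall N, N != setT -> ~ pairing (R := R) A i N) ->
  forall h : local_cohomology I E i, exists h' : local_cohomology I E i, smon x setT *: h' = h.
Proof.
move=> x_reg IE npair h; have [v hv] := lc_rep_ex h.
have [tv dv] := lc_repP hv; have [n nv] := torsion_ann tv.
(* Exponent n already kills v; n.+1 is moreover positive. The next stage [u2] is where divisibility
   appears. *)
pose u1 j := x j ^+ n.+1; pose u2 j := u1 j * x j.
have u1_reg : perm_regular u1 by apply: x_reg.
have u2E : u2 = fun j => x j ^+ n.+2 by apply: funext => j; rewrite /u2 /u1 -exprSr.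
have u2_reg : perm_regular u2 by rewrite u2E; apply: x_reg.
have smI a : smon x (A a) \in I by rewrite IE; apply: (mem_gen (j := a)).
have u1v a : smon u1 (A a) *: v = 0.
  by rewrite smonX exprS -scalerA nv ?scaler0.
have tor q (w : res_obj E q) : (forall a, smon u2 (A a) *: w = 0) -> w \in torsion I (res_obj E q).
  move=> u2w; apply: (torsion_gen (g := fun a => smon x (A a)) (e := fun=> n.+2)).
    by move=> r; rewrite IE.
  by move=> a; rewrite -smonX -u2E u2w.
have dcomp u (B : lmodType R) (f : {set 'I_s} -> B) sg :
    act (taylor u A) (act (taylor u A) f) sg = 0 by apply: act_taylor_comp.
have [||c [hc Dc zc]] := zigzag_fwd (@taylor_deg _ _ _ A u1) (dcomp u1) (hom_point v).
- by move=> sg; rewrite /point; case: ifP => _; rewrite ?dv ?raddf0.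
- exact: act_taylor_point.
rewrite addn0 in hc.
have [p [b [hp Dp cE]]] := cocycle_decomposition iota u1_reg npair hc Dc.
pose b0 (sg : {set 'I_s}) : R^o := if #|sg|.+1 == i then b sg else 0.
have {}cE sg : c sg = p sg + act (taylor u1 A) b0 sg.
  have [si|si] := eqVneq #|sg| i; last first.
    rewrite hc// hp ?(negPf si)// add0r /act big1// => tau _; rewrite /b0.
    case: eqP => [ti|_]; last by rewrite scaler0.
    have [->|/taylor_deg st] := eqVneq (taylor u1 A sg tau) 0; first by rewrite scale0r.
    by rewrite st ti eqxx in si.
  rewrite cE; congr (_ + _); apply: eq_bigr => tau _; rewrite /b0; case: ifP => // ti.
  have [->|/taylor_deg st] := eqVneq (taylor u1 A sg tau) 0; first by rewrite mul0r scale0r.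
  by rewrite -st si eqxx in ti.
have p0 sg : cup A sg != setT -> p sg = 0 by move=> sT; rewrite hp// negb_and sT orbT.
(* Between sets with full union the Taylor coefficients are bare incidence numbers, so p is a
   cocycle at every stage. *)
have Dp2 sg : act (taylor u2 A) (p : _ -> R^o) sg = 0.
  apply: (smon_lreg u2_reg (H := ~: cup A sg)); rewrite -[act _ _ _]/(ract (taylor u2 A) p sg).
  rewrite -ract_incid -[RHS](Dp sg); apply: eq_bigr => tau _; congr (_ * _).
  have [->|/p0->] := eqVneq (cup A tau) setT; last by rewrite mulr0.
  by rewrite setCT smon0 mul1r.
have ex2 q (w : {set 'I_s} -> res_obj E q) : (forall sg, act (taylor u2 A) w sg = 0) ->
    (forall sg : {set 'I_s}, #|sg| = 0%N -> w sg = 0) ->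
    exists v : {set 'I_s} -> res_obj E q, forall sg, w sg = act (taylor u2 A) v sg.
  by apply: taylor_cochain_exact => //; apply: res_injective.
have hp' : hom_deg deg (i + 0) (p : _ -> R^o).
  by move=> sg; rewrite addn0 => si; rewrite hp ?(negPf si).
have [f [hf Df df zf]] := zigzag_bwd (@taylor_deg _ _ _ A u2) ex2 hp' Dp2.
pose v2 := f set0.
have fE sg : f sg = point v2 sg.
  by rewrite /point; case: eqP => [->//|/eqP s0]; rewrite hf// cards_eq0.
have tv2 : v2 \in torsion I (res_obj E i).
  by apply: tor => a; rewrite -act_taylor_set1 Df.
have [h' hh'] := lc_rep_mk tv2 (df set0).
exists h'; apply/esym/(proj2 (lc_rep_eq hv (lc_repZ (smon x setT) hh'))).
pose y := smon x setT.
have zc2 : zigzag (E := E) deg (taylor u2 A) 0 (fun sg => smon x (cup A sg) *: point v sg)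
    (fun sg => smon x (cup A sg) *: c sg).
  by apply: zigzag_map zc => B g sg; apply: act_taylorM.
(* The transition map multiplies p by y throughout its support, so the image of c is y p up to a
   coboundary, although p itself is a cocycle of the new stage. At the empty set the scaling is 1,
   and v is unchanged. *)
have bE sg : - y *: (p sg : R^o) + smon x (cup A sg) *: c sg =
    act (taylor u2 A) (fun tau => smon x (cup A tau) *: b0 tau) sg.
  rewrite act_taylorM cE scalerDr addrA -[RHS]add0r; congr (_ + _).
  have [->|/p0->] := eqVneq (cup A sg) setT; last by rewrite !scaler0 addr0.
  by rewrite scaleNr addNr.
have uE sg : - y *: f sg + smon x (cup A sg) *: point v sg = point (v - y *: v2) sg.
  rewrite fE /point; case: eqP => [->|_]; last by rewrite !scaler0 addr0.
  by rewrite cup0 smon0 scale1r addrC scaleNr.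
have := zigzag_lin (- y) zf zc2; rewrite (funext bE) (funext uE) => zb.
apply: (zigzag_lc_bound u2_reg tor zb) => sg si.
by rewrite /b0 (negPf si) scaler0.
Qed.
End Surjectivity.

(** * Balancing Tor between the Koszul and the Taylor complex *)

Lemma koszul_ract (R : comNzRingType) (d : nat) (y : 'I_d -> R) (X Y : finType)
    (D : X -> Y -> R) (w : {set 'I_d} -> Y -> R) F t :
  koszul y (fun F => ract D (w F) t) F = ract D (fun z => koszul y (w^~ z) F) t.
Proof.
rewrite koszulE; under eq_bigr do rewrite !mulr_sumr.
rewrite exchange_big; apply: eq_bigr => z _ /=; rewrite koszulE mulr_sumr.
by apply: eq_bigr => a _; ring.
Qed.

Lemma koszulM (R : comNzRingType) (d : nat) (u w : 'I_d -> R) (f : {set 'I_d} -> R) F :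
  koszul (fun j => u j * w j) (fun F => smon w F * f F) F = smon w F * koszul u f F.
Proof.
rewrite !koszulE mulr_sumr; apply: eq_bigr => a aF.
by rewrite [smon w F](big_setD1 a)//= /smon; ring.
Qed.

Lemma koszul_mem (R : comNzRingType) (d : nat) (y : 'I_d -> R) (f : {set 'I_d} -> R) F :
  koszul y f F \in gen (fun=> true) y.
Proof.
rewrite koszulE; apply: ideal_sum => a _; apply: ideal_mulr.
exact: (mem_gen (j := a)).
Qed.

Lemma koszul0 (R : comNzRingType) (d : nat) (y : 'I_d -> R) (f : {set 'I_d} -> R) F :
  (forall F, f F = 0) -> koszul y f F = 0.
Proof. by move=> f0; rewrite koszulE big1// => a _; rewrite f0 !mulr0. Qed.

Section Balance.
Context {R : comNzRingType} {d s : nat} (x : 'I_d -> R) (A : 'I_s -> {set 'I_d}).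
Hypothesis x_reg : perm_regular x.
Implicit Types (F : {set 'I_d}) (sg tau : {set 'I_s}).
Implicit Types (w z b g : {set 'I_d} -> {set 'I_s} -> R) (u : 'I_d -> R).
Local Notation bd := (ract (transp (taylor x A))).

Definition kos u w F sg : R := koszul u (w^~ sg) F.

(* A zigzag of length [e] in the tensor product of the Koszul cochain complex
   and the Taylor complex: it balances Tor between its two factors. *)
Fixpoint balanced u (e : nat) w z : Prop :=
  match e with
  | 0 => w = z
  | e'.+1 => exists w', [/\ forall F sg, kos u w F sg = bd (w' F) sg,
                            forall F, w' F set0 = 0 & balanced u e' w' z]
  end.

Lemma bd_bd (f : {set 'I_s} -> R) sg : bd (bd f) sg = 0.
Proof. by rewrite !ract_act act_taylorT_comp. Qed.

Lemma bdB (f f' : {set 'I_s} -> R) sg : bd (fun t => f t - f' t) sg = bd f sg - bd f' sg.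
Proof. exact: ractB. Qed.

Lemma kos_bd u w F sg : kos u (fun F => bd (w F)) F sg = bd (kos u w F) sg.
Proof. exact: koszul_ract. Qed.

Lemma bd_set0 (f f' : {set 'I_s} -> R) : (forall sg, sg != set0 -> f sg = f' sg) ->
  forall tau, bd f tau = bd f' tau.
Proof.
move=> ff' tau; apply: eq_bigr => sg _; rewrite /transp.
have [->|/ff'->//] := eqVneq sg set0.
have [->|/taylor_nz[_]] := eqVneq (taylor x A set0 tau) 0; first by rewrite !mul0r.
by rewrite cards0.
Qed.

Lemma bd_exact w : (forall F tau, bd (w F) tau = 0) -> (forall F, w F set0 = 0) ->
  exists g, (forall F, g F set0 = 0) /\ forall F sg, w F sg = bd (g F) sg.
Proof.
move=> bw w0; have /choice[g gE] F : exists h, forall sg, w F sg = bd h sg.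
  by apply: taylor_exact.
exists (fun F sg => if sg == set0 then 0 else g F sg); split=> [F|F sg].
  by rewrite eqxx.
by rewrite gE; apply: bd_set0 => tau /negPf->.
Qed.

Lemma balanced_map u u' (th : {set 'I_d} -> R) e w z :
  (forall f F, koszul u' (fun F => th F * f F) F = th F * koszul u f F) ->
  balanced u e w z ->
  balanced u' e (fun F sg => th F * w F sg) (fun F sg => th F * z F sg).
Proof.
move=> uu'; elim: e w => [|e IH] w /=; first by move->.
move=> [w' [kw w0 bw]]; exists (fun F sg => th F * w' F sg); split=> [F sg|F|].
- by rewrite /kos uu' -[koszul u _ F]/(kos u w F sg) kw ractZ.
- by rewrite w0 mulr0.
- exact: IH.
Qed.

(** In each step w' - kos u g is a Taylor cycle, hence a Taylor boundary, and g takes the place of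
    b. *)
Lemma balanced_bound u e w z b g : balanced u e w z -> (forall F, g F set0 = 0) ->
  (forall F sg, w F sg = kos u b F sg + bd (g F) sg) ->
  exists b' g', forall F sg, z F sg = kos u b' F sg + bd (g' F) sg.
Proof.
elim: e w b g => [|e IH] w b g /=; first by move=> -> _ wE; exists b, g.
move=> [w' [kw w0 bw]] g0 wE.
pose w1 F sg := w' F sg - kos u g F sg.
have kg0 F : kos u g F set0 = 0 by apply: koszul0.
have [||g' [g'0 g'E]] := @bd_exact w1.
- move=> F tau; rewrite bdB -kw -kos_bd; apply/eqP; rewrite subr_eq0; apply/eqP.
  rewrite /kos -[LHS]subr0 -(koszul_koszul u (b^~ tau) F) -koszulB.
  congr (koszul u _ F); apply: funext => F'; rewrite wE addrAC subrr add0r.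
  by [].
- by move=> F; rewrite /w1 w0 kg0 subr0.
by apply: (IH w' g g') => // F sg; rewrite -g'E /w1 addrC subrK.
Qed.

Variables (u : 'I_d -> R) (i : nat).
Hypothesis u_exact : forall p (f : {set 'I_d} -> R), (p < d)%N ->
  homog p (f : {set 'I_d} -> R^o) -> koszul u f =1 (fun=> 0) ->
  exists2 g, (forall F : {set 'I_d}, #|F|.+1 != p -> g F = 0) & f =1 koszul u g.

(** The zigzag descends diagonally from bidegree (d, i), each new term being lifted by Koszul
    exactness below degree d. The last clause is used at e = i: it makes the values at [set0] a
    Koszul cocycle modulo I. *)
Lemma balanced_ex z w0 e :
  (forall F sg, ~~ ((#|F| == d) && (#|sg| == i)) -> z F sg = 0) ->
  (forall F sg, bd (z F) sg = kos u w0 F sg) ->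
  (forall F sg, ~~ ((#|F|.+1 == d) && (#|sg|.+1 == i)) -> w0 F sg = 0) ->
  (e <= i)%N -> (e <= d)%N ->
  exists w, [/\ balanced u e w z,
     forall F sg, ~~ ((#|F| + e == d) && (#|sg| + e == i))%N -> w F sg = 0,
     exists2 w', forall F sg, bd (w F) sg = kos u w' F sg &
       forall F sg, ~~ ((#|F| + e.+1 == d) && (#|sg| + e.+1 == i))%N -> w' F sg = 0 &
     exists w', forall F sg, kos u w F sg = bd (w' F) sg].
Proof.
move=> zs zw0 w0s; elim: e => [|e IH] ei ed.
  exists z; split=> //.
  - by move=> F sg; rewrite !addn0 => /zs.
  - by exists w0 => // F sg; rewrite !addn1 => /w0s.
  exists (fun _ _ => 0) => F sg; rewrite /kos koszulE [RHS]big1 => [|t _]; last by rewrite mulr0.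
  rewrite big1// => a aF; rewrite zs ?mulr0// negb_and; apply/orP; left.
  have := subset_leq_card (subsetT F); rewrite cardsT card_ord (cardsD1 a F) aF add1n => Fd.
  by rewrite neq_ltn Fd.
have [w [bw ws [w' ww' w's] _]] := IH (ltnW ei) (ltnW ed).
exists w'; split=> //=.
- exists w; split=> // F; apply: ws; rewrite cards0 add0n negb_and.
  by rewrite (ltn_eqF ei) orbT.
- have dd : (d - e.+1 < d)%N by rewrite ltn_subrL /= (leq_trans _ ed).
  have /choice[g gE] sg : exists g : {set 'I_d} -> R, [/\
      forall F, bd (w' F) sg = koszul u g F &
      forall F, ~~ ((#|F| + e.+2 == d) && (#|sg| + e.+2 == i))%N -> g F = 0].
    have bs F : ~~ ((#|F| + e.+1 == d) && (#|sg| + e.+2 == i))%N -> bd (w' F) sg = 0.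
      move=> nFs; rewrite /ract big1// => t _; rewrite /transp.
      have [->|/taylor_nz[_ ts]] := eqVneq (taylor x A t sg) 0; first by rewrite mul0r.
      by rewrite w's ?mulr0// ts addSnnS.
    case: (boolP (#|sg| + e.+2 == i)%N) => si; last first.
      by exists (fun=> 0); split=> // F; rewrite bs ?koszul0// negb_and si orbT.
    have [||g gh gE] := u_exact (f := fun F => bd (w' F) sg) dd.
    - move=> F Fp; apply: bs; rewrite negb_and; apply/orP; left.
      by apply: contra Fp => /eqP Fp; rewrite -{1}(addnK e.+1 #|F|) Fp.
    - move=> F; rewrite -[LHS]/(kos u (fun F => bd (w' F)) F sg) kos_bd.
      rewrite (_ : kos u w' F = bd (w F)) ?bd_bd//.
      by apply: funext => t; rewrite ww'.
    exists g; split=> [F|F]; first by rewrite gE.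
    rewrite andbT => Fp; apply: gh; apply: contra Fp => /eqP Fp.
    by rewrite addnS -addSn Fp subnK.
  exists (fun F sg => g sg F) => F sg; first by case: (gE sg).
  by move=> nFs; case: (gE sg) => _; apply.
by exists w => F sg; rewrite ww'.
Qed.

End Balance.

(** * Nonzero local cohomology classes of R / I *)

Section PairingClass.
Context {R : comNzRingType} {d s : nat} (x : 'I_d -> R) (A : 'I_s -> {set 'I_d}).
Implicit Types (sg tau : {set 'I_s}).
Variables (i : nat) (N : {set 'I_d}) (phi zeta : {set 'I_s} -> R).
Hypothesis phi_zeta_supp : forall sg, ~~ ((#|sg| == i) && (N \subset cup A sg)) ->
  phi sg = 0 /\ zeta sg = 0.
Hypothesis phi_cycle : forall tau, N \subset cup A tau -> \sum_sg phi sg * incid sg tau = 0.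
Hypothesis zeta_cocycle : forall rho : {set 'I_s}, \sum_tau incid rho tau * zeta tau = 0.
Hypothesis phi_zeta1 : \sum_sg phi sg * zeta sg = 1.
Local Notation bd := (ract (transp (taylor x A))).

(* As the numerator over (x_1 ... x_d)^(m + 2) of a coefficient of the face [sg], it
   has multidegree 0 on [N] and -1 elsewhere, except for -1 - t at [j], once the
   degree of [sg] is added. *)
Definition tor_mon (m t : nat) (j : 'I_d) sg : R :=
  \prod_l x l ^+ (if l \in N then m.+1 else m.+1 - (l \in cup A sg) - (if l == j then t else 0))%N.

Lemma smon_prod (u : 'I_d -> R) (H : {set 'I_d}) : smon u H = \prod_l u l ^+ (l \in H).
Proof. by rewrite /smon big_mkcond; apply: eq_bigr => l _; case: ifP. Qed.

Lemma tor_mon_top m j sg : N \subset cup A sg ->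
  smon x (cup A sg :\: N) * tor_mon m 0 j sg = \prod_l x l ^+ m.+1.
Proof.
move=> Ns; rewrite smon_prod -big_split; apply: eq_bigr => l _ /=.
rewrite -exprD inE if_same subn0; congr (_ ^+ _); case: ifP => //= lN.
by rewrite subnKC//; case: (l \in _).
Qed.

(** Multiplication by x_j^t undoes the lowered degree in x_j. The bound t <= m keeps m + 1 - 1 - t a
    true subtraction. *)
Lemma tor_mon_shift m n t j sg : j \notin N -> (t <= m)%N ->
  x j ^+ t * smon (fun l => x l ^+ n) setT * tor_mon m t j sg = tor_mon (m + n) 0 j sg.
Proof.
move=> jN tm; have -> : x j ^+ t = \prod_l x l ^+ (if l == j then t else 0)%N.
  by rewrite (bigD1 j)//= eqxx big1 ?mulr1// => l /negPf->.
rewrite smon_prod -!big_split; apply: eq_bigr => l _ /=.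
rewrite in_setT expr1 -!exprD if_same subn0; congr (_ ^+ _).
case: (boolP (l \in N)) => lN; last first.
  by case: (l == j); case: (l \in cup A sg) => /=; lia.
by rewrite (negPf (_ : l != j)) ?add0n 1?addnC//; apply: contraNneq jN => <-.
Qed.

Lemma tor_mon_taylor m t j sg tau : j \notin N -> (t <= m)%N -> tau \subset sg ->
  N \subset cup A tau ->
  tor_mon m t j sg * smon x (cup A sg :\: cup A tau) = tor_mon m t j tau.
Proof.
move=> jN tm ts Nt; rewrite smon_prod -big_split; apply: eq_bigr => l _ /=.
rewrite -exprD inE; congr (_ ^+ _); have /subsetP/(_ l) := cup_subset A ts.
case: (boolP (l \in N)) => lN; first by rewrite (subsetP Nt)// addn0.
case: (l \in cup A tau) => [/(_ isT)->|_]; first by rewrite addn0.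
by case: (l \in cup A sg) => /=; case: ifP => _; lia.
Qed.

(** If the union of tau contains N, phi is a cycle there. Otherwise it misses some l in N, and the
    factor x_l of the Taylor coefficient raises the exponent m.+1 to m.+2. *)
Lemma bd_tor_mon m t j tau : j \notin N -> (t <= m)%N ->
  bd (fun sg => phi sg * tor_mon m t j sg) tau \in gen (fun=> true) (fun l => x l ^+ m.+2).
Proof.
move=> jN tm; have [Nt|] := boolP (N \subset cup A tau).
  rewrite (_ : ract _ _ _ = tor_mon m t j tau * \sum_sg phi sg * incid sg tau).
    by rewrite phi_cycle// mulr0 ideal0.
  rewrite mulr_sumr; apply: eq_bigr => sg _; rewrite /transp /taylor.
  have [->|/incid_nz[ts _]] := eqVneq (incid sg tau : R) 0; first by rewrite !(mul0r, mulr0).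
  by rewrite -(tor_mon_taylor jN tm ts Nt); ring.
move=> /subsetPn[l lN lt]; apply: ideal_sum => sg _; rewrite /transp /taylor.
have [Ns|nNs] := boolP (N \subset cup A sg); last first.
  by rewrite (proj1 (phi_zeta_supp _)) ?mul0r ?mulr0 ?ideal0// (negPf nNs) andbF.
rewrite [X in X \in _](_ : _ = (incid sg tau * phi sg) *
   (smon x (cup A sg :\: cup A tau) * tor_mon m t j sg)); last by ring.
apply: ideal_mull; rewrite /tor_mon (bigD1 l)//= lN.
rewrite /smon (big_setD1 l)/=; last by rewrite inE lt (subsetP Ns).
rewrite mulrACA -exprS; apply: ideal_mulr.
exact: (mem_gen (j := l)).
Qed.

(** The functional with coefficients zeta times the monomial of cup A sg :\: N kills Taylor
    boundaries, as zeta is a cocycle, and sends the class to the monomial excluded by hypothesis. *)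
Lemma pairing_nonzero m j (xi : {set 'I_s} -> R) :
  \prod_l x l ^+ m.+1 \notin gen (fun=> true) (fun l => x l ^+ m.+2) ->
  ~ forall sg, phi sg * tor_mon m 0 j sg - bd xi sg \in gen (fun=> true) (fun l => x l ^+ m.+2).
Proof.
move=> /negP xm xiP; apply: xm.
have : \sum_sg (zeta sg * smon x (cup A sg :\: N)) *
    (phi sg * tor_mon m 0 j sg - bd xi sg) \in gen (fun=> true) (fun l => x l ^+ m.+2).
  by apply: ideal_sum => sg _; apply: ideal_mull.
rewrite [X in X \in _](_ : _ = \prod_l x l ^+ m.+1)//.
under [LHS]eq_bigr do rewrite mulrBr.
rewrite sumrB.
rewrite [X in X - _](_ : _ = \prod_l x l ^+ m.+1); last first.
  transitivity ((\sum_sg phi sg * zeta sg) * \prod_l x l ^+ m.+1); last first.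
    by rewrite phi_zeta1 mul1r.
  rewrite mulr_suml; apply: eq_bigr => sg _.
  have [/andP[_ Ns]|/phi_zeta_supp[-> ->]] := boolP ((#|sg| == i) && (N \subset cup A sg)).
    by rewrite -(tor_mon_top m j Ns); ring.
  by rewrite !mul0r.
rewrite [X in _ - X](_ : _ = 0) ?subr0//.
under eq_bigr do rewrite mulr_sumr.
rewrite exchange_big big1// => rho _ /=.
rewrite (eq_bigr (fun sg => (xi rho * smon x (cup A rho :\: N)) * (incid rho sg * zeta sg))).
  by rewrite -mulr_sumr zeta_cocycle mulr0.
move=> sg _; rewrite /transp /taylor.
have [/andP[_ Ns]|/phi_zeta_supp[_ ->]] := boolP ((#|sg| == i) && (N \subset cup A sg)).
  have [->|/incid_nz[ts _]] := eqVneq (incid rho sg : R) 0; first by rewrite !(mul0r, mulr0).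
  rewrite (@smonD _ _ x (cup A rho :\: N) (cup A sg :\: N)); last first.
    by apply/setSD/cup_subset.
  rewrite (_ : _ :\: _ :\: _ = cup A rho :\: cup A sg); first by ring.
  apply/setP => l; rewrite !inE; have /subsetP/(_ l) := Ns.
  by case: (l \in N) => [/(_ isT)->|_]; case: (l \in cup A sg).
by rewrite !(mul0r, mulr0).
Qed.

End PairingClass.

Section FiniteLength.
Context {R : comNzRingType} (m : ideal R) {d s : nat}.
Context (x : 'I_d -> R) (A : 'I_s -> {set 'I_d}) (I : ideal R) (i : nat).
Context (E : injective_resolution (quotmod I)).
Hypothesis nR : noetherian R.
Hypothesis lm : local_ring m.
Hypothesis depth_d : depth m d.
Hypothesis x_sop : system_of_parameters m x.
Hypothesis IE : I =i gen (fun=> true) (fun a => smon x (A a)).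
Local Notation bd := (ract (transp (taylor x A))).
Local Notation vars := (fun a : 'I_d => [set a]).
Implicit Types (F : {set 'I_d}) (sg tau : {set 'I_s}).

Lemma sop_perm_regular : perm_regular x.
Proof.
rewrite (_ : x = fun l => x l ^+ 1); last by apply: funext => l; rewrite expr1.
exact: (sop_exp_perm_regular nR lm depth_d x_sop (a := fun=> 1%N)).
Qed.

Lemma bd_set0_ideal (f : {set 'I_s} -> R) : bd f set0 \in I.
Proof.
apply: ideal_sum => sg _; apply: ideal_mulr; rewrite /transp.
have [->|/taylor_nz[_]] := eqVneq (taylor x A sg set0) 0; first exact: ideal0.
rewrite cards0 => /eqP/cards1P[a ->].
rewrite /taylor incid_set1 mul1r cup0 cup_set1 setD0 IE.
exact: (mem_gen (j := a)).
Qed.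

Lemma mem_ideal_bd r : r \in I -> exists f : {set 'I_s} -> R,
  f set0 = 0 /\ forall sg, bd f sg = if sg == set0 then r else 0.
Proof.
rewrite IE => /genP[c ->]; pose f sg : R := \sum_a (sg == [set a])%:R * c a.
have f1 a : f [set a] = c a.
  rewrite /f (bigD1 a)//= eqxx mul1r big1 ?addr0// => b ba.
  by rewrite (inj_eq set1_inj) eq_sym (negPf ba) mul0r.
have f0 sg : #|sg| != 1%N -> f sg = 0.
  move=> s1; rewrite /f big1// => a _; case: eqP => [sE|_]; last by rewrite mul0r.
  by rewrite sE cards1 in s1.
exists f; split=> [|sg]; first by rewrite f0// cards0.
case: eqP => [->|/eqP s0]; last first.
  rewrite /ract big1// => tau _; rewrite /transp.
  have [->|/taylor_nz[_ tE]] := eqVneq (taylor x A tau sg) 0; first by rewrite mul0r.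
  by rewrite f0 ?mulr0// tE eqSS cards_eq0.
rewrite /ract (eq_bigr (fun tau => \sum_a (tau == [set a])%:R * (c a * smon x (A a)))); last first.
  move=> tau _; rewrite /f mulr_sumr; apply: eq_bigr => a _; rewrite /transp.
  case: eqP => [->|_]; last by rewrite !(mul0r, mulr0).
  by rewrite /taylor incid_set1 !mul1r cup0 cup_set1 setD0 mulrC.
rewrite exchange_big; apply: eq_bigr => a _ /=.
by rewrite (bigD1 [set a])//= eqxx mul1r big1 ?addr0// => t /negPf->; rewrite mul0r.
Qed.

Lemma lc_kill J (M : lmodType R) (EM : injective_resolution M) q
    (h : local_cohomology J EM q) v a :
  lc_rep h v -> a *: h = 0 <-> lc_bound J (a *: v).
Proof.
move=> hv; have := lc_rep_eq (lc_repZ a hv) (lc_repZ 0 hv).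
by rewrite !scale0r subr0.
Qed.

Lemma lc_torsion J (M : lmodType R) (EM : injective_resolution M) q a
    (h : local_cohomology J EM q) : a \in J -> exists n, a ^+ n *: h = 0.
Proof.
move=> aJ; have [v hv] := lc_rep_ex h; have [/torsion_ann[n nv] _] := lc_repP hv.
exists n; apply: (proj2 (lc_kill _ hv)); rewrite nv//.
case: q {h v hv nv} => [|q] //=; exists 0; rewrite ?raddf0//.
exact: rpred0.
Qed.

(** An element bounding the multiple of the class is torsion, so all x_l^n kill it for some n; once
    the exponents are raised by n it is a Koszul cocycle, and [zigzag_bound] applies. *)
Lemma lc_bound_zigzag (M : lmodType R) (EM : injective_resolution M) q
    (f : {set 'I_d} -> res_obj EM q) (c : {set 'I_d} -> M) (u : 'I_d -> R) (a : R) :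
  (forall n, zigzag (E := EM) (fun F => #|F|) (taylor (fun l => u l * x l ^+ n) vars) 0
     (fun F => (a * smon (fun l => x l ^+ n) F) *: f F)
     (fun F => (a * smon (fun l => x l ^+ n) F) *: c F)) ->
  (forall F, f F = point (f set0) F) ->
  lc_bound m (a *: f set0) ->
  exists n (b : {set 'I_d} -> M), forall F,
    (a * smon (fun l => x l ^+ n) F) *: c F =
    act (taylor (fun l => u l * x l ^+ n) vars) b F.
Proof.
move=> zth fE.
have thE n F : (a * smon (fun l => x l ^+ n) F) *: f F = point (a *: f set0) F.
  rewrite fE /point; case: eqP => [->|_]; last by rewrite scaler0.
  by rewrite smon0 mulr1.
case: q f zth fE thE => [|q] f zth fE thE /=.
  move=> af; exists 0%N, (fun=> 0) => F; have [_ /(_ F)] := zth 0%N.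
  rewrite thE af /point if_same => /esym aF; rewrite act0//.
  by apply: (res_aug_inj (i := EM)); rewrite aF raddf0.
move=> [v tv vE]; have [n nv] := torsion_ann tv; exists n.
have [|||b bE] := zigzag_bound _ (zth n) (v := point v).
- by move=> B g F; apply: act_taylor_comp.
- by move=> F; rewrite thE -vE /point; case: ifP; rewrite ?raddf0.
- apply: act_taylor_point => l; rewrite smonM smonX /smon !big_set1 -scalerA nv ?scaler0//.
  exact: sop_mem x_sop l.
by exists b.
Qed.

Section NonVanishing.
Variables (N : {set 'I_d}) (j : 'I_d) (phi zeta : {set 'I_s} -> R) (t : nat).
Hypothesis jN : j \notin N.
Hypothesis supp : forall sg, ~~ ((#|sg| == i) && (N \subset cup A sg)) ->
  phi sg = 0 /\ zeta sg = 0.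
Hypothesis phi_cycle : forall tau, N \subset cup A tau -> \sum_sg phi sg * incid sg tau = 0.
Hypothesis zeta_cocycle : forall rho : {set 'I_s}, \sum_tau incid rho tau * zeta tau = 0.
Hypothesis phi_zeta1 : \sum_sg phi sg * zeta sg = 1.

Definition top_class F sg : R :=
  if F == setT then phi sg * tor_mon x A N t t j sg else 0.

(** Carried back along the zigzag, a bounding pair for the multiple of w bounds phi times the top
    monomials modulo the powers t + n + 2, against [pairing_nonzero]. *)
Lemma top_class_nonzero e w n (b g : {set 'I_d} -> {set 'I_s} -> R) :
  balanced x A (fun l => x l ^+ t.+2) e w top_class -> (forall F, g F set0 = 0) ->
  (forall F sg, x j ^+ t * smon (fun l => x l ^+ n) F * w F sg =
     kos (fun l => x l ^+ t.+2 * x l ^+ n) b F sg + bd (g F) sg) -> False.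
Proof.
set u := fun l => _ * _ => bw g0 wE.
have uE : u = fun l => x l ^+ (t + n).+2 by apply: funext => l; rewrite /u -exprD !addSn.
have [|b' [g' zE]] := balanced_bound sop_perm_regular (balanced_map (u' := u)
  (th := fun F => x j ^+ t * smon (fun l => x l ^+ n) F) _ bw) g0 wE.
  move=> f F; rewrite -mulrA -koszulM !koszulE mulr_sumr.
  by apply: eq_bigr => a _; rewrite /u /=; ring.
have := sop_monomial nR lm depth_d x_sop (t + n).
move=> /(pairing_nonzero supp zeta_cocycle phi_zeta1 (j := j) (xi := g' setT)); apply => sg.
have := zE setT sg; rewrite /top_class eqxx => /esym/(canRL (addrK _)) kE.
rewrite -(tor_mon_shift x A n sg jN (leqnn t)) [phi sg * _]mulrCA.
by rewrite -kE /kos uE koszul_mem.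
Qed.

Lemma top_class_supp F sg : ~~ ((#|F| == d) && (#|sg| == i)) -> top_class F sg = 0.
Proof.
rewrite /top_class; case: (F =P setT) => // ->; rewrite cardsT card_ord eqxx/= => si.
by rewrite (proj1 (supp _)) ?mul0r// (negPf si).
Qed.

Lemma top_class_boundary : exists w0 : {set 'I_d} -> {set 'I_s} -> R,
  (forall F sg, bd (top_class F) sg = kos (fun l => x l ^+ t.+2) w0 F sg) /\
  (forall F sg, ~~ ((#|F|.+1 == d) && (#|sg|.+1 == i)) -> w0 F sg = 0).
Proof.
have d0 : (0 < d)%N by case: (j) => a; case: (d).
have /choice[w0 w0P] sg : exists f : {set 'I_d} -> R,
    (forall F, bd (top_class F) sg = koszul (fun l => x l ^+ t.+2) f F) /\
    (forall F, ~~ ((#|F|.+1 == d) && (#|sg|.+1 == i)) -> f F = 0).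
  have bT F : F != setT -> bd (top_class F) sg = 0.
    by move=> /negPf FT; rewrite /ract big1// => tau _; rewrite /top_class FT mulr0.
  have [si|si] := eqVneq #|sg|.+1 i; last first.
    exists (fun=> 0); split=> // F; rewrite koszul0// /ract big1// => tau _; rewrite /transp.
    have [->|/taylor_nz[_ tE]] := eqVneq (taylor x A tau sg) 0; first by rewrite mul0r.
    by rewrite top_class_supp ?mulr0// tE (negPf si) andbF.
  have := bd_tor_mon x supp phi_cycle sg jN (leqnn t) => /genP[c cE].
  have [f [hf _ fT]] := koszul_top (fun l => x l ^+ t.+2) c d0.
  exists f; split=> [F|F]; last first.
    by rewrite andbT => Fd; apply: hf; apply: contra Fd => /eqP->; rewrite prednK.
  rewrite fT; case: (F =P setT) => [->|/eqP/bT//]; rewrite -cE; apply: eq_bigr => tau _.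
  by rewrite /top_class eqxx.
by exists (fun F sg => w0 sg F); split=> F sg; case: (w0P sg) => h1 h2; [apply: h1|apply: h2].
Qed.

Lemma top_class_balanced e : (e <= i)%N -> (e <= d)%N ->
  exists w, [/\ balanced x A (fun l => x l ^+ t.+2) e w top_class,
     forall F sg, ~~ ((#|F| + e == d) && (#|sg| + e == i))%N -> w F sg = 0,
     exists2 w', forall F sg, bd (w F) sg = kos (fun l => x l ^+ t.+2) w' F sg &
       forall F sg, ~~ ((#|F| + e.+1 == d) && (#|sg| + e.+1 == i))%N -> w' F sg = 0 &
     exists w', forall F sg, kos (fun l => x l ^+ t.+2) w F sg = bd (w' F) sg].
Proof.
move=> ei ed; have [w0 [bw0 w0s]] := top_class_boundary.
apply: (balanced_ex _ top_class_supp bw0 w0s ei ed) => p f.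
exact: (koszul_sop_exact depth_d x_sop (a := fun=> t.+2)).
Qed.

(* Tor_i vanishes above the length of the Koszul complex. *)
Lemma pairing_degree : t = 0%N -> (i <= d)%N.
Proof.
move=> t0; rewrite leqNgt; apply/negP => di.
have [w [bw ws [w' bw' w's] _]] := top_class_balanced (ltnW di) (leqnn d).
(* At e = d the term w has Koszul degree 0, so w' would have degree -1 and vanishes: w is a Taylor
   cycle of positive degree i - d. *)
have [||g [g0 gE]] := @bd_exact R d s x A sop_perm_regular w.
- move=> F sg; rewrite bw' /kos koszul0// => F'; apply: w's.
  by rewrite negb_and gtn_eqF// addnS ltnS leq_addl.
- by move=> F; apply: ws; rewrite cards0 add0n (ltn_eqF di) andbF.
apply: (top_class_nonzero (n := 0) (b := fun _ _ => 0) (g := g) bw g0) => F sg.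
rewrite /kos koszul0// add0r t0 expr0 mul1r gE (_ : smon _ F = 1) ?mul1r//.
by rewrite /smon big1.
Qed.

(** At e = i the zigzag reaches Taylor degree 0. Modulo I its end is a Koszul cocycle of degree d -
    i, which represents a local cohomology class of R / I. *)
Lemma pairing_not_killed : (i <= d)%N ->
  ~ (forall h : local_cohomology m E (d - i), x j ^+ t *: h = 0).
Proof.
move=> id kill; pose u l := x l ^+ t.+2.
have u_reg : perm_regular u by apply: (sop_exp_perm_regular nR lm depth_d x_sop (a := fun=> t.+2)).
have [w [bw ws _ [w' kw]]] := top_class_balanced (leqnn i) id.
pose c F : quotmod I := quotmod_pi I (w F set0).
have hc : hom_deg (fun F => #|F|) (d - i + 0) c.
  move=> F Fd; rewrite /c ws ?raddf0// cards0 add0n eqxx andbT.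
  by apply: contra Fd => /eqP; rewrite addn0; lia.
have kosc y (f : {set 'I_d} -> R) F :
    act (taylor y vars) (fun F => quotmod_pi I (f F)) F = quotmod_pi I (koszul y f F).
  by rewrite (act_linear (quotmod_pi I)) -ract_koszul.
have Dc F : act (taylor u vars) c F = 0.
  rewrite kosc -[koszul _ _ _]/(kos u w F set0) kw; apply/eqP; rewrite quotmod_pi0.
  exact: bd_set0_ideal.
have exu y q (v : {set 'I_d} -> res_obj E q) : perm_regular y ->
    (forall F, act (taylor y vars) v F = 0) ->
    (forall F, #|F| = 0%N -> v F = 0) ->
    exists v' : {set 'I_d} -> res_obj E q, forall F, v F = act (taylor y vars) v' F.
  by move=> y_reg; apply: taylor_cochain_exact => //; apply: res_injective.
have [f [hf Df df zf]] := zigzag_bwd (@taylor_deg _ _ _ vars u) (fun q v => exu u q v u_reg) hc Dc.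
have fE F : f F = point (f set0) F.
  by rewrite /point; case: eqP => [->//|/eqP s0]; rewrite hf// cards_eq0.
have smv y a : smon y [set a] = y a :> R by rewrite /smon big_set1.
have tf : f set0 \in torsion m (res_obj E (d - i)).
  apply: (torsion_sop (n := t.+2) nR x_sop) => a.
  by have := Df [set a]; rewrite act_taylor_set1 smv.
have [h hh] := lc_rep_mk tf (df set0).
have := proj1 (lc_kill _ hh) (kill h).
have zth n : zigzag (E := E) (fun F => #|F|) (taylor (fun l => u l * x l ^+ n) vars) 0
    (fun F => (x j ^+ t * smon (fun l => x l ^+ n) F) *: f F)
    (fun F => (x j ^+ t * smon (fun l => x l ^+ n) F) *: c F).
  apply: zigzag_map zf => B g F.
  transitivity (x j ^+ t *: act (taylor (fun l => u l * x l ^+ n) vars)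
      (fun F => smon (fun l => x l ^+ n) (cup vars F) *: g F) F).
    rewrite scaler_sumr; apply: eq_bigr => G _; rewrite cup_id !scalerA.
    by congr (_ *: _); ring.
  by rewrite act_taylorM cup_id scalerA.
have key n (b : {set 'I_d} -> quotmod I) :
    (forall F, (x j ^+ t * smon (fun l => x l ^+ n) F) *: c F =
       act (taylor (fun l => u l * x l ^+ n) vars) b F) -> False.
  move=> cb; have /choice[b' b'E] F := quotmod_piP (b F).
  (* The bounding cochain is lifted from R / I to R; the error lies in I, hence is a Taylor
     boundary. *)
  have /choice[g gP] F : exists g : {set 'I_s} -> R, g set0 = 0 /\ forall sg, bd g sg =
      if sg == set0 then x j ^+ t * smon (fun l => x l ^+ n) F * w F set0
        - koszul (fun l => u l * x l ^+ n) b' F else 0.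
    apply/mem_ideal_bd/quotmod_pi_eq.
    by rewrite -kosc -(eq_act _ _ b'E) -cb /c -linearZ.
  apply: (top_class_nonzero (n := n) (b := fun F sg => if sg == set0 then b' F else 0)
    (g := g) bw) => [F|F sg]; first by case: (gP F).
  have [_ ->] := gP F; case: eqP => [->|/eqP s0].
    rewrite /kos (_ : (fun F => _) = b') 1?addrC ?subrK//.
    by apply: funext => G; rewrite eqxx.
  have si : (#|sg| + i == i)%N = false by rewrite -{2}[i]add0n eqn_add2r cards_eq0 (negPf s0).
  rewrite addr0 ws ?si ?andbF// mulr0.
  by rewrite /kos koszul0// => G; rewrite (negPf s0).
move=> /(lc_bound_zigzag zth fE)[n [b]]; exact: key.
Qed.

End NonVanishing.

Lemma finite_length_no_pairing (N : {set 'I_d}) :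
  ((i <= d)%N -> finite_length (local_cohomology m E (d - i))) ->
  N != setT -> ~ pairing (R := R) A i N.
Proof.
move=> fin NT [phi [zeta [supp cyc coc one]]].
have [j jN] : exists j, j \notin N.
  by move: NT; rewrite eqEsubset subsetT => /subsetPn[j _ jN]; exists j.
have id : (i <= d)%N by apply: (pairing_degree (t := 0) jN supp cyc coc one).
have [t kill] := finite_length_kill (fin id) (fun h => lc_torsion h (sop_mem x_sop j)).
exact: (pairing_not_killed jN supp cyc coc one id kill).
Qed.

End FiniteLength.

Lemma krull_dim_unique (R : comNzRingType) n p : krull_dim R n -> krull_dim R p -> n = p.
Proof.
move=> [[P cP] nmax] [[Q cQ] pmax]; apply/eqP.
by rewrite eqn_leq (pmax _ _ cP) (nmax _ _ cQ).
Qed.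

Theorem proposition3p8 (R : idomainType) (m : ideal R)
    (k : fieldType) (pi : {rmorphism R -> k}) (iota : {rmorphism k -> R})
    (d : nat) (x : 'I_d -> R) (I : ideal R) (i : nat)
    (ER : injective_resolution (R^o : lmodType R))
    (EQ : injective_resolution (quotmod I)) :
  noetherian R ->
  local_ring m ->
  residue_map m pi ->
  krull_dim R d ->
  (0 < d)%N ->
  cohen_macaulay m ->
  system_of_parameters m x ->
  squarefree_monomial_ideal x I ->
  {subset I <= m} ->
  ((i <= d)%N -> finite_length (local_cohomology m EQ (d - i))) ->
  exists2 y : R, y \in I &
    forall h : local_cohomology I ER i,
      exists h' : local_cohomology I ER i, y *: h' = h.
Proof.
move=> nR lm _ dimd d0 [n dimn depthn] sop [S IS] _ fin.
have depth_d : depth m d by rewrite (krull_dim_unique dimd dimn).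
pose A (a : 'I_#|S|) : {set 'I_d} := enum_val a.
have IE : I =i gen (fun=> true) (fun a => smon x (A a)).
  move=> r; rewrite IS; apply/idP/idP.
    apply: span_sub => _ [H HS ->]; apply: (mem_gen (j := enum_rank_in HS H)) => //.
    by rewrite /A enum_rankK_in.
  by apply: gen_sub => a _; apply: mem_span; exists (A a) => //; apply: enum_valP.
have npair := finite_length_no_pairing nR lm depth_d sop IE fin.
(* The product of all variables lies in I as soon as there is a generator; the case I = 0 is
   separate, with 0 as multiplier. *)
have [S0|[H HS]] := set_0Vmem S; last first.
  exists (smon x setT).
    rewrite IS -[smon x setT]mulr1 (smonD x (subsetT H)) -mulrA; apply: ideal_mulr.
    by apply: mem_span; exists H.
  apply: (local_cohomology_divisible iota _ IE npair) => n'.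
  exact: (sop_exp_perm_regular nR lm depth_d sop (a := fun=> n'.+1)).
have noindex (a : 'I_#|S|) : False by case: a => a; rewrite S0 cards0.
exists 0; first exact: rpred0.
move=> h; exists h; have [v hv] := lc_rep_ex h.
apply: (proj2 (lc_rep_eq (lc_repZ 0 hv) hv)); rewrite scale0r sub0r.
have [_ dv] := lc_repP hv; case: i ER EQ fin npair h v hv dv => [|q] ER' EQ' _ npair h v hv dv /=.
  (* For I = 0 and i = 0 the empty face pairs with itself. As d > 0, this is a pairing at N = [set0]
     different from [setT], which finite length forbids. *)
  exfalso; apply: (npair set0).
    by apply/eqP => /setP/(_ (Ordinal d0)); rewrite !inE.
  exists (fun sg => (sg == set0)%:R), (fun sg => (sg == set0)%:R); split.
  - by move=> sg; rewrite cards_eq0 sub0set andbT => /negPf->.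
  - by move=> tau _; rewrite big1// => sg _; rewrite /incid big1 ?mulr0.
  - by move=> rho; rewrite big1// => tau _; rewrite /incid big1 ?mul0r.
  by rewrite (bigD1 set0)//= eqxx mulr1 big1 ?addr0// => sg /negPf->; rewrite mulr0.
have [u uv] : exists u, res_diff ER' q u = - v.
  by apply: res_diff_exact; rewrite linearN dv oppr0.
(* For I = 0 every element is torsion, so exactness of the resolution makes positive cohomology
   vanish. *)
exists u => //; apply: (torsion_gen (e := fun=> 0%N)) => [r|a]; first by rewrite IE; apply.
by case: (noindex a).
Qed.
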